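(* Let $\overline{D}\subset\mathbb{C}$ be a closed disc and let $F:\overline{D}\to\mathbb{C}$ be a continuous function. Suppose that there is a set $E\subset\overline{D}$ of zero Lebesgue measure such that $F^{-1}\{F(\zeta)\}$ is at most countable for every $\zeta\in\overline{D}\setminus E$. Suppose furthermore that for each $\zeta\in\overline{D}\setminus E$ there exists an open sector $S(0;I_\zeta)$ with vertex at $0\in\mathbb{C}$ such that $$(z-\zeta)\{F(z)-F(\zeta)\}\in S(0;I_\zeta)\qquad\text{for all } z\in\overline{D}\setminus F^{-1}\{F(\zeta)\}.$$ Then $[z,F]_{\overline{D}}=\mathcal{C}(\overline{D})$.
   Context: An open sector with vertex at $a\in\mathbb{C}$ is a set of the form $S(a;I)=\{a+re^{i\theta}: r>0,\ \theta\in I\}$, where $I$ is an open subinterval of $[-2\pi,2\pi)$ with $\mathrm{length}(I)<2\pi$ (so the interior angle may exceed $\pi$). For a compact set $K\subset\mathbb{C}$, $\mathcal{C}(K)$ is the algebra of complex-valued continuous functions on $K$ with the uniform norm. For $\phi_1,\dots,\phi_N\in\mathcal{C}(K)$, $[\phi_1,\dots,\phi_N]_K$ denotes the set of all $f\in\mathcal{C}(K)$ that can be approximated uniformly on $K$ by complex polynomials in $\phi_1,\dots,\phi_N$. In $[z,F]_{\overline{D}}$, $z$ denotes the identity function. For $\zeta\in\overline{D}$, $F^{-1}\{F(\zeta)\}=\{z\in\overline{D}:F(z)=F(\zeta)\}$. *)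

(* Defs.v *)
(* Complex numbers are R[i] over a realType R. The regular copy R[i]^o carries
   the norm topology of the plane; plain R[i] has no topology in the library. *)
From HB Require Import structures.
From mathcomp Require Import all_boot all_order all_algebra.
From mathcomp Require Import all_classical all_reals all_analysis.
From mathcomp Require Import complex.
(* not imported: the notations of mpoly clash with those of the analysis library *)
From mathcomp Require mpoly.
Set Implicit Arguments.
Unset Strict Implicit.
Unset Printing Implicit Defensive.
Import Order.TTheory GRing.Theory Num.Theory.
Import numFieldNormedType.Exports.
Local Open Scope classical_set_scope.
Local Open Scope complex_scope.
Local Open Scope ring_scope.

Definition closed_disc (R : realType) (c : R[i]^o) (r : R) : set R[i]^o :=
  closed_ball_ Num.norm c r%:C.

(* Null sets of the completed Lebesgue measure on the plane: subsets of a
   Borel set of measure zero. *)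
Definition lebesgue_null (R : realType) (E : set R[i]^o) : Prop :=
  ((@lebesgue_measure R \x @lebesgue_measure R)%E).-negligible
    [set p : R * R | E (p.1 +i* p.2)].

(* Open subintervals of [-2 pi, 2 pi[ of length < 2 pi. *)
Definition sector_interval (R : realType) (I : set R) : Prop :=
  exists a b : R, [/\ - (2 * pi) <= a, a < b, b <= 2 * pi, b - a < 2 * pi
    & I = `]a, b[%classic].

Definition open_sector (R : realType) (a : R[i]^o) (I : set R) : set R[i]^o :=
  [set w | exists r t : R, [/\ 0 < r, I t
    & w = a + r%:C * (cos t +i* sin t)]].

(* Elements of C(K) are represented by functions on the whole plane, of which
   only the restriction to K matters. *)
Definition continuous_on (R : realType) (K : set R[i]^o) :
    set (R[i]^o -> R[i]^o) :=
  [set f | {within K, continuous f}].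

(* [phi_1, ..., phi_N]_K *)
Definition poly_closure (R : realType) (K : set R[i]^o) (N : nat)
    (phi : N.-tuple (R[i]^o -> R[i]^o)) : set (R[i]^o -> R[i]^o) :=
  [set f | continuous_on K f /\
    forall eps : R, 0 < eps -> exists p : mpoly.mpoly N R[i],
      forall z, K z ->
        `|f z - mpoly.meval (fun i => tnth phi i z) p| < eps%:C].

(* F^-1 {F zeta}, for F defined on K *)
Definition level_set (R : realType) (K : set R[i]^o) (F : R[i]^o -> R[i]^o)
    (zeta : R[i]^o) : set R[i]^o :=
  [set z | K z /\ F z = F zeta].

(* Main.v *)
Require Import Defs.
From mathcomp Require Import all_boot all_order all_algebra.
From mathcomp Require Import all_classical all_reals all_analysis.
From mathcomp Require Import measurable_realfun.
From mathcomp Require Import complex ring lra.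
(* The notations of multivariate polynomials clash with those of analysis. *)
From mathcomp Require Import (canonicals) mpoly.
Set Implicit Arguments.
Unset Strict Implicit.
Unset Printing Implicit Defensive.
Import Order.TTheory GRing.Theory Num.Theory.
Import numFieldNormedType.Exports.
Import ComplexField.Normc.
Local Open Scope classical_set_scope.
Local Open Scope complex_scope.
Local Open Scope ring_scope.

(** The classical argument is by duality.  A measure on the disc that
annihilates the polynomials in z and F has a Cauchy transform that vanishes
almost everywhere, because for almost every zeta the kernel 1 / (z - zeta) is a
bounded pointwise limit, relative to its own size, of polynomials in z and F;
hence the measure is zero.  The proof below keeps this mechanism but replaces
duality by explicit uniform approximations.

It is enough to put the conjugate of z into the uniform closure, since z and
its conjugate generate a dense subalgebra of the continuous functions
([conj_dense]).

For zeta outside E put h = (z - zeta) (F z - F zeta).  The sector hypothesis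
keeps the values of h, as z varies, at distance at least k l from the point of
modulus l of some ray, for a k > 0 and all l.  The inverse of h + l e, where - e directs the ray, is then
uniformly approximable by polynomials in h for every l > 0: this is clear for
large l, and the pole can be pushed towards 0 by geometric steps
([resolvent_step]).  With l small this gives a polynomial p such that
1 - h p(h) is bounded, and small where h is not small ([sector_poly]).
Consequently (F z - F zeta) p(h), a polynomial in z and F, differs from
1 / (z - zeta) by a small multiple of 1 / |z - zeta|, and by a bounded multiple
of it where h is small.
When zeta is outside the disc a geometric series does the same
([approximable_outside]).

Rays of rational angle and apertures 1 / (m + 1) cover all cases, so finitely
many of them serve all zeta in a square Q around the disc up to a set of small
area ([approximable_exhaustion]).  For a given z, the set of zeta where h is
small shrinks to a level set of F, which is null, being contained in E or
countable; by compactness of the disc its area tends to 0 uniformly in z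
([near_level_uniform]).  As 1 / |z - zeta| is uniformly integrable in zeta
([weight_small]), the Cauchy transform of any bounded measurable function on Q
is a uniform limit on the disc of elements of the algebra
([cauchy_transform_approx]).

A regularised Cauchy-Pompeiu formula ([cauchy_pompeiu_reg]) exhibits such Cauchy
transforms: for g vanishing on the boundary of Q, the transform of the
derivative of g is the mean of g against a kernel concentrated near z.  Taking
for g a function m that is positive on the disc, and then x m, and dividing,
gives Re z in the closure ([Re_in_closure]); the mass of the concentrating
kernel cancels in the quotient and need not be computed.  The conjugate of z is
2 Re z - z. *)

(** * The modulus of a complex number *)
Section Modulus.
Variable R : realType.
Implicit Types (x y z : R[i]) (a b : R).

Lemma normc_ge0 z : 0 <= normc z.
Proof. by case: z => a b; rewrite /normc sqrtr_ge0. Qed.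

Lemma normc_sqr z : normc z ^+ 2 = complex.Re z ^+ 2 + complex.Im z ^+ 2.
Proof. by case: z => a b /=; rewrite sqr_sqrtr ?addr_ge0 ?sqr_ge0. Qed.

Lemma normcR a : normc a%:C = `|a|.
Proof. by rewrite /normc /= expr0n addr0 sqrtr_sqr. Qed.

Lemma normcB x y : normc (x - y) = normc (y - x).
Proof. by rewrite -normcN opprB. Qed.

Lemma le_normcB x y : normc (x - y) <= normc x + normc y.
Proof. by rewrite -[normc y]normcN le_normcD. Qed.

Lemma ler_normcB x y : normc x - normc y <= normc (x - y).
Proof. by rewrite lerBlDr -{1}(subrK y x) le_normcD. Qed.

Lemma normc_eq0 z : (normc z == 0) = (z == 0).
Proof.
apply/eqP/eqP => [/eq0_normc//|->]; exact: normc0.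
Qed.

Lemma normc_gt0 z : (0 < normc z) = (z != 0).
Proof. by rewrite lt_def normc_ge0 andbT normc_eq0. Qed.

Lemma normcX z n : normc (z ^+ n) = normc z ^+ n.
Proof. by elim: n => [|n IH]; rewrite ?expr0 ?normc1// !exprS normcM IH. Qed.

Lemma Re_le_normc z : `|complex.Re z| <= normc z.
Proof.
rewrite -(ler_pXn2r (n:=2)) ?nnegrE ?normc_ge0// normc_sqr.
by rewrite real_normK ?num_real// lerDl sqr_ge0.
Qed.

Lemma Im_le_normc z : `|complex.Im z| <= normc z.
Proof.
rewrite -(ler_pXn2r (n:=2)) ?nnegrE ?normc_ge0// normc_sqr.
by rewrite real_normK ?num_real// lerDr sqr_ge0.
Qed.

Lemma normc_le_ReIm z : normc z <= `|complex.Re z| + `|complex.Im z|.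
Proof.
rewrite -(ler_pXn2r (n:=2)) ?nnegrE ?normc_ge0 ?addr_ge0// normc_sqr sqrrD.
rewrite -[complex.Re z ^+ 2]real_normK ?num_real//.
rewrite -[complex.Im z ^+ 2]real_normK ?num_real//.
by rewrite lerD2r lerDl mulrn_wge0// mulr_ge0.
Qed.

Lemma Re_mulc (x y : R[i]) : complex.Re (x * y) =
  complex.Re x * complex.Re y - complex.Im x * complex.Im y.
Proof. by case: x y => [a b] [c d]. Qed.

Lemma Im_mulc (x y : R[i]) : complex.Im (x * y) =
  complex.Re x * complex.Im y + complex.Im x * complex.Re y.
Proof. by case: x y => [a b] [c d]. Qed.

Lemma Re_invc (x : R[i]) : complex.Re x^-1 = complex.Re x / (normc x ^+ 2).
Proof. by rewrite normc_sqr; case: x. Qed.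

Lemma Im_invc (x : R[i]) : complex.Im x^-1 = - complex.Im x / (normc x ^+ 2).
Proof. by rewrite normc_sqr mulNr; case: x. Qed.

End Modulus.

Lemma expr_small (R : realType) (q e : R) : 0 <= q < 1 -> 0 < e ->
  exists n, q ^+ n < e.
Proof.
move=> /andP[q0 q1] e0.
have /cvgrPdist_lt/(_ _ e0)[n _ /(_ n (leqnn n))] : (fun n => q ^+ n) @ \oo --> 0.
  by apply: cvg_expr; rewrite ger0_norm.
by rewrite /= sub0r normrN ger0_norm ?exprn_ge0// => ?; exists n.
Qed.

(** * Uniform closure of an algebra of functions *)
Section UniformClosure.
Variables (R : realType) (T : Type) (X : set T).
Implicit Types (G : set (T -> R[i])) (f g : T -> R[i]).

Definition subalg G := [/\ forall c : R[i], G (fun=> c),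
  forall f g, G f -> G g -> G (fun x => f x + g x)
  & forall f g, G f -> G g -> G (fun x => f x * g x)].

Definition uclos G f := forall e : R, 0 < e ->
  exists2 g, G g & forall x, X x -> normc (f x - g x) <= e.

Definition bounded_on f := exists M : R, forall x, X x -> normc (f x) <= M.

(** Boundedness on [X] is what makes the uniform closure stable under products. *)
Definition buclos G f := uclos G f /\ bounded_on f.

Lemma subalg_buclos G : subalg G -> subalg (buclos G).
Proof.
move=> [Gc GD GM]; split.
- move=> c; split; last by exists (normc c).
  by move=> e e0; exists (fun=> c) => // x _; rewrite subrr normc0 ltW.
- move=> f g [cf [Mf bf]] [cg [Mg bg]]; split.
    move=> e e0; have e20 : 0 < e / 2 by rewrite divr_gt0.
    have [f' Gf' ff'] := cf _ e20; have [g' Gg' gg'] := cg _ e20.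
    exists (fun x => f' x + g' x); first exact: GD.
    move=> x Xx; have := ff' x Xx; have := gg' x Xx => h1 h2.
    rewrite opprD addrACA (le_trans (le_normcD _ _))//; lra.
  exists (Mf + Mg) => x Xx; have := bf x Xx; have := bg x Xx => h1 h2.
  rewrite (le_trans (le_normcD _ _))//; lra.
- move=> f g [cf [Mf bf]] [cg [Mg bg]]; split; last first.
    exists (Mf * Mg) => x Xx; rewrite normcM ler_pM ?normc_ge0//; [exact: bf|exact: bg].
  move=> e e0.
  pose A := 1 + `|Mf|; pose B := 1 + `|Mg|.
  have A1 : 1 <= A by rewrite lerDl.
  have B1 : 1 <= B by rewrite lerDl.
  pose d := Num.min 1 (e / (2 * (A + B))).
  have AB0 : 0 < 2 * (A + B) by lra.
  have d0 : 0 < d by rewrite lt_min ltr01 divr_gt0.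
  have d1 : d <= 1 by rewrite ge_min lexx.
  have de : d * (A + B) <= e / 2.
    have : d <= e / (2 * (A + B)) by rewrite ge_min lexx orbT.
    rewrite ler_pdivlMr// => h; lra.
  have [f' Gf' ff'] := cf _ d0; have [g' Gg' gg'] := cg _ d0.
  exists (fun x => f' x * g' x); first exact: GM.
  move=> x Xx; have h1 := ff' x Xx; have h2 := gg' x Xx.
  have -> : f x * g x - f' x * g' x = (f x - f' x) * g x + f' x * (g x - g' x).
    by ring.
  rewrite (le_trans (le_normcD _ _))// !normcM.
  have hf : normc (f' x) <= A.
    have -> : f' x = f x - (f x - f' x) by ring.
    rewrite (le_trans (le_normcB _ _))// /A.
    by have := bf x Xx; have := ler_norm Mf; lra.
  have hg : normc (g x) <= B.
    by rewrite /B; have := bg x Xx; have := ler_norm Mg; lra.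
  have h3 : normc (f x - f' x) * normc (g x) <= d * B by rewrite ler_pM ?normc_ge0.
  have h4 : normc (f' x) * normc (g x - g' x) <= A * d by rewrite ler_pM ?normc_ge0.
  by lra.
Qed.

Lemma buclos_sub G f : G f -> bounded_on f -> buclos G f.
Proof.
by move=> Gf bf; split=> // e e0; exists f => // x _; rewrite subrr normc0 ltW.
Qed.

Lemma buclos_idem G f : uclos (buclos G) f -> buclos G f.
Proof.
move=> cf; split.
  move=> e e0; have e20 : 0 < e / 2 by rewrite divr_gt0.
  have [g [cg _] fg] := cf _ e20; have [g' Gg' gg'] := cg _ e20.
  exists g' => // x Xx; have := fg x Xx; have := gg' x Xx => h1 h2.
  have -> : f x - g' x = (f x - g x) + (g x - g' x) by ring.
  rewrite (le_trans (le_normcD _ _))//; lra.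
have [g [_ [M bg]] fg] := cf 1 ltr01.
exists (1 + M) => x Xx; have := fg x Xx; have := bg x Xx => h1 h2.
have -> : f x = (f x - g x) + g x by ring.
rewrite (le_trans (le_normcD _ _))//; lra.
Qed.

Lemma subalgN G f : subalg G -> G f -> G (fun x => - f x).
Proof.
move=> [Gc GD GM] Gf; have := GM _ _ (Gc (-1)) Gf.
by congr G; apply/funext => x; rewrite mulN1r.
Qed.

Lemma subalgX G f n : subalg G -> G f -> G (fun x => f x ^+ n).
Proof.
move=> [Gc GD GM] Gf; elim: n => [|n IH]; first exact: (Gc 1).
by have := GM _ _ Gf IH; congr G; apply/funext => x; rewrite exprS.
Qed.

Lemma subalg_sum G (I : Type) (s : seq I) (F : I -> T -> R[i]) : subalg G ->
  (forall i, G (F i)) -> G (fun x => \sum_(i <- s) F i x).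
Proof.
move=> [Gc GD GM] GF; elim: s => [|i s IH].
  by have := Gc 0; congr G; apply/funext => x; rewrite big_nil.
by have := GD _ _ (GF i) IH; congr G; apply/funext => x; rewrite big_cons.
Qed.

(** The inverse is a Neumann series in [1 - f], whose partial sums are in the
closure. *)
Lemma buclos_inv G f (q : R) : subalg G -> q < 1 ->
  (forall x, X x -> normc (1 - f x) <= q) ->
  buclos G f -> buclos G (fun x => (f x)^-1).
Proof.
move=> GA q1 fq cf; apply: buclos_idem => e e0.
have BA := subalg_buclos GA; have [Bc BD BM] := BA.
have [X0|/set0P[x0 Xx0]] := eqVneq X set0.
  by exists (fun=> 0); [exact: Bc|rewrite X0].
have q0 : 0 <= q by rewrite (le_trans _ (fq _ Xx0))// normc_ge0.
have q1' : 0 < 1 - q by rewrite subr_gt0.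
have [n qn] := @expr_small R q (e * (1 - q)) (introT andP (conj q0 q1)) (mulr_gt0 e0 q1').
exists (fun x => \sum_(k < n) (1 - f x) ^+ k).
  apply: subalg_sum => // k; apply: subalgX => //.
  apply: BD; [exact: (Bc 1)|exact: subalgN].
move=> x Xx.
have fge : 1 - q <= normc (f x).
  have := ler_normcB 1 (1 - f x); rewrite normc1 opprB addrCA subrr addr0 => h.
  by have := fq x Xx; lra.
have fx0 : f x != 0 by rewrite -normc_gt0 (lt_le_trans q1').
have -> : (f x)^-1 - \sum_(k < n) (1 - f x) ^+ k = (1 - f x) ^+ n / f x.
  apply: (mulfI fx0); rewrite mulrBr divff// [RHS]mulrCA divff// mulr1.
  have := subrX1 (1 - f x) n.
  have -> : 1 - f x - 1 = - f x by ring.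
  by move=> /eqP; rewrite subr_eq => /eqP ->; ring.
rewrite normcM normcV normcX ler_pdivrMr; last by rewrite normc_gt0.
rewrite (@le_trans _ _ (q ^+ n))//.
  by rewrite lerXn2r// ?nnegrE ?normc_ge0//; exact: fq.
by rewrite (le_trans (ltW qn))// ler_wpM2l// ltW.
Qed.

End UniformClosure.

(** * Polynomials that invert h away from a ray *)
Section SectorPoly.
Variables (R : realType) (M k : R) (e : R[i]).
Hypotheses (k0 : 0 < k) (k1 : k <= 1) (e1 : normc e = 1).

(** Relative distance at least [k] from the points of the ray opposite to [e].
Unlike membership in an open sector, this is a closed condition, it allows
[h = 0], and countably many pairs [(k, e)] cover all sectors. *)
Definition avoids_ray : set R[i] :=
  [set h | forall l : R, 0 <= l -> k * l <= normc (h + l%:C * e)].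

Definition polyfun : set (R[i] -> R[i]) := [set f | exists p : {poly R[i]}, f = horner p].

Let X : set R[i] := [set h | normc h <= M] `&` avoids_ray.

Lemma subalg_polyfun : subalg polyfun.
Proof.
split.
- by move=> c; exists c%:P; apply/funext => x; rewrite hornerC.
- by move=> _ _ [p ->] [q ->]; exists (p + q); apply/funext => x; rewrite hornerD.
- by move=> _ _ [p ->] [q ->]; exists (p * q); apply/funext => x; rewrite hornerM.
Qed.

Let BA := subalg_buclos X subalg_polyfun.

Let e_neq0 : e != 0.
Proof. by rewrite -normc_gt0 e1. Qed.

Lemma buclos_id : buclos X polyfun id.
Proof.
apply: buclos_sub; first by exists 'X; apply/funext => x; rewrite hornerX.
by exists M => x [].
Qed.

(** The pole is so far away that a geometric series in [h] converges uniformly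
on [normc h <= M]. *)
Lemma resolvent_far l : 0 < l -> 2 * M <= l ->
  buclos X polyfun (fun h => (h + l%:C * e)^-1).
Proof.
move=> l0 Ml; have [Bc BD BM] := BA.
have lc0 : l%:C * e != 0.
  by rewrite mulf_neq0// eq_complex /= eqxx andbT gt_eqF.
have nl : normc (l%:C * e) = l by rewrite normcM e1 mulr1 normcR gtr0_norm.
pose f (h : R[i]) := 1 + (l%:C * e)^-1 * h.
have cf : buclos X polyfun f.
  by apply: BD; [exact: Bc|apply: BM; [exact: Bc|exact: buclos_id]].
have fq h : X h -> normc (1 - f h) <= 2^-1.
  move=> [hM _]; rewrite /f opprD addrA subrr add0r normcN normcM normcV nl.
  by rewrite mulrC ler_pdivrMr//; move: hM => /=; lra.
have := BM _ _ (Bc (l%:C * e)^-1) (buclos_inv subalg_polyfun _ fq cf).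
move=> /(_ _)/wrap[]; first by lra.
congr (buclos X polyfun _); apply/funext => h.
by rewrite -invfM mulrC mulrDl mul1r mulrAC mulVf// mul1r addrC.
Qed.

(** Pole pushing: [h + l e = (h + l' e) f] with
[f = 1 - (l' - l) e / (h + l' e)], and [f] is within 1/2 of 1 because
[l' - l <= k l' / 2 <= |h + l' e| / 2]. *)
Lemma resolvent_step l l' : 0 < l' -> l <= l' -> (1 - k / 2) * l' <= l ->
  buclos X polyfun (fun h => (h + l'%:C * e)^-1) ->
  buclos X polyfun (fun h => (h + l%:C * e)^-1).
Proof.
move=> l'0 ll' lk cl; have [Bc BD BM] := BA.
pose f (h : R[i]) := 1 - (l' - l)%:C * e * (h + l'%:C * e)^-1.
have cf : buclos X polyfun f.
  by apply: BD; [exact: Bc|apply: subalgN => //; apply: BM => //; exact: Bc].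
have pos h : X h -> 0 < normc (h + l'%:C * e).
  by move=> [_ /(_ l' (ltW l'0))]; apply: lt_le_trans; rewrite mulr_gt0.
have fq h : X h -> normc (1 - f h) <= 2^-1.
  move=> Xh; rewrite /f opprB addrCA subrr addr0 normcM normcV normcM e1 mulr1.
  rewrite normcR ger0_norm ?subr_ge0// ler_pdivrMr ?pos//.
  by have [_ /(_ l' (ltW l'0))] := Xh; lra.
have := BM _ _ cl (buclos_inv subalg_polyfun _ fq cf).
move=> /(_ _)/wrap[]; first by lra.
move=> [cl' bl]; split.
  move=> d d0; have [g Gg gd] := cl' _ d0; exists g => // h Xh.
  rewrite (le_trans _ (gd h Xh))// le_eqVlt; apply/orP; left; apply/eqP.
  congr (normc (_ - _)); rewrite -invfM; congr (_^-1).
  rewrite /f mulrBr mulr1 mulrCA divff ?mulr1 -?normc_gt0 ?pos//.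
  by rewrite rmorphB /=; ring.
have [B bB] := bl; exists B => h Xh.
rewrite (le_trans _ (bB h Xh))// le_eqVlt; apply/orP; left; apply/eqP.
congr (normc _); rewrite -invfM; congr (_^-1).
rewrite /f mulrBr mulr1 mulrCA divff ?mulr1 -?normc_gt0 ?pos//.
by rewrite rmorphB /=; ring.
Qed.

Lemma resolvent l : 0 < l -> buclos X polyfun (fun h => (h + l%:C * e)^-1).
Proof.
move=> l0; pose L := 1 + `|2 * M|.
have L0 : 0 < L by rewrite /L ltr_pwDl.
have q0 : 0 < 1 - k / 2 by move: k1; lra.
have q1 : 1 - k / 2 < 1 by move: k0; lra.
have [n qn] := @expr_small R (1 - k / 2) (l / L) (introT andP (conj (ltW q0) q1)) (divr_gt0 l0 L0).
have {qn} : (1 - k / 2) ^+ n * L <= l by rewrite -ler_pdivlMr// ltW.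
elim: n l l0 => [|n IH] l l0 ln.
  apply: resolvent_far => //; rewrite (le_trans (ler_norm _))//.
  by move: ln; rewrite expr0 mul1r /L; lra.
apply: (@resolvent_step _ (l / (1 - k / 2))).
- by rewrite divr_gt0.
- by rewrite ler_pdivlMr// ler_piMr ?ltW.
- by rewrite mulrC divfK// gt_eqF.
- by apply: IH; rewrite ?divr_gt0// ler_pdivlMr// mulrAC -exprSr.
Qed.

(** The bound [k l] is good for large [l]; for small [l] the triangle inequality
gives a bound in terms of [h]. *)
Lemma avoids_ray_le h l : avoids_ray h -> 0 <= l -> k / 2 * normc h <= normc (h + l%:C * e).
Proof.
move=> hX l0; have := hX l l0 => h1.
have := ler_normcB h (- (l%:C * e)); rewrite opprK normcN normcM e1 mulr1 normcR ger0_norm// => h2.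
have n0 := normc_ge0 h.
have [hl|hl] := lerP (2 * l) (normc h).
  have : k / 2 * normc h <= 2^-1 * normc h by rewrite ler_wpM2r//; move: k1; lra.
  lra.
have : k * (normc h / 2) <= k * l by rewrite ler_pM2l//; move: hl; lra.
lra.
Qed.

(** The polynomial approximates [1 / (h + l e)]: then [1 - h p(h)] is close to
[l e / (h + l e)], which is at most [1 / k] in modulus, and small for
[|h| >= d] once [l] is small.  The bound on all values does not depend on [d]
and [t]. *)
Lemma sector_poly (d t : R) : 0 < d -> 0 < t ->
  exists p : {poly R[i]}, forall h, normc h <= M -> avoids_ray h ->
    normc (1 - h * p.[h]) <= k^-1 + 1 /\
    (d <= normc h -> normc (1 - h * p.[h]) <= t).
Proof.
move=> d0 t0.
(* [avoids_ray_le] then gives [|l e / (h + l e)| <= t / 2] when [d <= |h|]. *)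
pose l := t * d * k / 4; have l0 : 0 < l by rewrite /l !mulr_gt0.
pose M' := 1 + `|M|; have M'1 : 1 <= M' by rewrite /M' lerDl.
have M'0 : 0 < M' by lra.
pose s := Num.min 1 (t / 2) / M'.
have s0 : 0 < s by rewrite divr_gt0// lt_min ltr01 divr_gt0.
have [/(_ _ s0)[_ [p ->] hp] _] := resolvent l0.
exists p => h hM hX.
have hl : 0 < normc (h + l%:C * e).
  by rewrite (lt_le_trans _ (hX l (ltW l0)))// mulr_gt0.
have -> : 1 - h * p.[h] = l%:C * e / (h + l%:C * e) + h * ((h + l%:C * e)^-1 - p.[h]).
  rewrite mulrBr addrA -mulrDl [l%:C * e + h]addrC divff// -?normc_gt0//.
have E : normc (h * ((h + l%:C * e)^-1 - p.[h])) <= Num.min 1 (t / 2).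
  rewrite normcM -[leRHS](divfK (lt0r_neq0 M'0)) mulrC ler_pM ?normc_ge0//.
    exact: hp.
  by rewrite (le_trans hM)// (le_trans (ler_norm M))// /M'; lra.
move: E; rewrite le_min => /andP[E1 E2].
have N : normc (l%:C * e / (h + l%:C * e)) = l / normc (h + l%:C * e).
  by rewrite normcM normcV normcM e1 mulr1 normcR gtr0_norm.
split.
  rewrite (le_trans (le_normcD _ _))// lerD// N ler_pdivrMr//.
  by rewrite mulrC ler_pdivlMr// mulrC; exact: hX (ltW l0).
move=> dh; rewrite (le_trans (le_normcD _ _))// N.
suff : l / normc (h + l%:C * e) <= t / 2 by lra.
rewrite ler_pdivrMr//.
have h1 := avoids_ray_le hX (ltW l0).
have : t / 2 * (k / 2 * d) <= t / 2 * normc (h + l%:C * e).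
  rewrite ler_pM2l; last by lra.
  by rewrite (le_trans _ h1)// ler_wpM2l//; move: k0; lra.
rewrite /l; lra.
Qed.

End SectorPoly.

(** * Area measure in the plane *)
Lemma normc_continuous (R : realType) (T : topologicalType) (u v : T -> R) :
  continuous u -> continuous v -> continuous (fun t => normc (u t +i* v t)).
Proof.
move=> cu cv t; rewrite /normc.
apply: (@continuous_comp _ _ _ (fun t => u t ^+ 2 + v t ^+ 2) Num.sqrt);
  last exact: sqrt_continuous.
apply: continuousD.
- by apply: (@continuous_comp _ _ _ u (fun x => x ^+ 2)); [exact: cu|exact: exprn_continuous].
- by apply: (@continuous_comp _ _ _ v (fun x => x ^+ 2)); [exact: cv|exact: exprn_continuous].
Qed.

Lemma measurable_inv (R : realType) : measurable_fun setT (@GRing.inv R).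
Proof.
have -> : [set: R] = [set 0] `|` ~` [set 0] by rewrite setUv.
apply/measurable_funU => //; first exact: measurableC.
split.
  have E : {in [set 0], cst 0 =1 @GRing.inv R}.
    by move=> x; rewrite inE /= => ->; rewrite invr0.
  exact: eq_measurable_fun E (measurable_cst _).
apply: open_continuous_measurable_fun.
  by rewrite openC; exact: closed_eq.
move=> x; rewrite inE /= => /eqP x0.
by apply: (@continuousV _ _ idfun) => //; exact: id_continuous.
Qed.

(** Lebesgue measure on the line is defined on this copy of the real line, which
carries the Borel sigma-algebra. *)
Notation plane R := (measurableTypeR R * measurableTypeR R)%type.

Section PlaneMeasure.
Variable R : realType.
Implicit Types (A B S : set (plane R)).

Definition area : {measure set (plane R) -> \bar R} :=
  (@lebesgue_measure R \x @lebesgue_measure R)%E.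

Definition square (a b s : R) : set (plane R) :=
  [set` `[a - s, a + s]] `*` [set` `[b - s, b + s]].

(** The sigma-algebra is the product one, so an open set has to be written as a
countable union of boxes: those with rational centres suffice. *)
Lemma open_plane_measurable A : open A -> measurable A.
Proof.
move=> oA.
pose B (i : rat * rat * nat) :=
  ball (ratr i.1.1 : R) (i.2.+1%:R^-1) `*` ball (ratr i.1.2 : R) (i.2.+1%:R^-1).
have -> : A = \bigcup_(i in [set i | B i `<=` A]) B i.
  apply/seteqP; split=> [[x y] Axy|p [i /= iA ip]]; last exact: iA.
  have /nbhs_ballP[e /= e0 eA] : nbhs (x, y) A by exact: open_nbhs_nbhs.
  have [n ne] : exists n, n.+1%:R^-1 < e / 2.
    have := @near_infty_natSinv_lt R (PosNum (divr_gt0 e0 (ltr0Sn _ 1))).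
    by case=> n _ /(_ n (leqnn n)) /= ?; exists n.
  have : 0 < n.+1%:R^-1 :> R by rewrite invr_gt0.
  move: ne; set d := n.+1%:R^-1 => de d0.
  have [|q1 /[!in_itv]/= /andP[q1l q1r]] := @rat_in_itvoo R (x - d) x; first by lra.
  have [|q2 /[!in_itv]/= /andP[q2l q2r]] := @rat_in_itvoo R (y - d) y; first by lra.
  exists (q1, q2, n).
    move=> [u v] [/=]; rewrite /ball /= -/d => /ltr_normlP[u1 u2] /ltr_normlP[v1 v2].
    apply: eA; split; rewrite /ball /=; apply/ltr_normlP; split; lra.
  by split; rewrite /ball /= -/d; apply/ltr_normlP; split; lra.
rewrite bigcup_mkcond; apply: countable_bigcupT_measurable; first exact: countableP.
move=> i; case: ifP => // _.
by apply: measurableX; apply: open_measurable; exact: ball_open.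
Qed.

Lemma closed_plane_measurable A : closed A -> measurable A.
Proof. by move/closed_openC/open_plane_measurable/measurableC; rewrite setCK. Qed.

Lemma within_continuous_measurable A (f : plane R -> R) :
  measurable A -> {within A, continuous f} -> measurable_fun A f.
Proof.
move=> mA /continuousP cf; apply: (measurability _ (RGenOpens.measurableE R)).
move=> _ [_ [a [b ->] <-]].
have /open_subspaceP[V oV VD] := cf _ (@interval_open _ (BRight a) (BLeft b) isT isT).
rewrite setIC -VD; apply: measurableI => //; exact: open_plane_measurable.
Qed.

Lemma continuous_plane_measurable (f : plane R -> R) :
  continuous f -> measurable_fun setT f.
Proof.
by move=> cf; apply: within_continuous_measurable => //; exact: continuous_subspaceT.
Qed.

Lemma measurable_square a b s : measurable (square a b s).
Proof. by apply: measurableX; exact: measurable_itv. Qed.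

Lemma area_square a b s : 0 <= s -> area (square a b s) = ((2 * s) ^+ 2)%:E.
Proof.
move=> s0.
have E (u : R) : lebesgue_measure (`[u - s, u + s]%classic : set R) = (2 * s)%:E.
  rewrite lebesgue_measure_itv /= lte_fin; case: ifPn => h.
    by rewrite -EFinD; congr (_%:E); ring.
  by congr (_%:E); lra.
transitivity (lebesgue_measure (`[(a - s)%R, (a + s)%R]%classic : set R) *
              lebesgue_measure (`[(b - s)%R, (b + s)%R]%classic : set R))%E; last first.
  by rewrite !E -EFinM.
by apply: product_measure1E; exact: measurable_itv.
Qed.

Lemma area_square_fin a b s : 0 < s -> (area (square a b s) < +oo)%E.
Proof. by move=> s0; rewrite area_square ?ltry// ltW. Qed.

(** Continuity from above; the limit set only has to be contained in a null
set. *)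
Lemma shrinking_area (S : nat -> set (plane R)) (N : set (plane R)) (a : R) :
  0 < a -> (forall n, measurable (S n)) -> (area (S 0%N) < +oo)%E ->
  (forall n m, (n <= m)%N -> S m `<=` S n) ->
  measurable N -> area N = 0%E -> \bigcap_n S n `<=` N ->
  exists n, (area (S n) <= a%:E)%E.
Proof.
move=> a0 mS S0 Sdec mN N0 SN.
have mI : measurable (\bigcap_n S n) by exact: bigcapT_measurable.
have I0 : area (\bigcap_n S n) = 0%E.
  apply/eqP; rewrite eq_le measure_ge0 andbT -N0.
  by apply: le_measure; rewrite ?inE.
have Sdec' : {homo S : n m / (n <= m)%N >-> (m <= n)%O}.
  by move=> n m nm; apply/subsetPset; exact: Sdec.
have := nonincreasing_cvg_mu S0 mS mI Sdec'.
rewrite I0 => cS; have /cS[n _ /(_ n (leqnn n)) /= /ltW hn] : nbhs 0%E [set y : \bar R | (y < a%:E)%E].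
  by apply: open_nbhs_nbhs; split; [exact: open_ereal_lt_ereal|rewrite /= lte_fin].
by exists n.
Qed.

(** Already the vertical lines through a countable set form a null set. *)
Lemma countable_abscissa_null (L : set (plane R)) : countable L ->
  exists N, [/\ measurable N, area N = 0%E & L `<=` N].
Proof.
move=> cL; pose X : set R := [set p.1 | p in L].
have cX : countable X by exact: card_le_trans (card_image_le _ _) cL.
have mX : measurable (X : set (measurableTypeR R)) by exact: countable_measurable cX.
exists (X `*` setT); split.
- exact: measurableX.
- transitivity (lebesgue_measure X * lebesgue_measure [set: R])%E.
    exact: product_measure1E.
  by rewrite countable_lebesgue_measure0// mul0e.
- by move=> p Lp; split => //=; exists p.
Qed.

Lemma compact_square a b s : compact (square a b s).
Proof. by apply: compact_setX; exact: segment_compact. Qed.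

Definition pt (p : plane R) : R[i] := p.1 +i* p.2.

Lemma pt_ReIm z : pt (complex.Re z, complex.Im z) = z.
Proof. by case: z. Qed.

Lemma normc_pt_continuous z : continuous (fun p : plane R => normc (z - pt p)).
Proof.
case: z => a b; apply: normc_continuous => p.
- by apply: cvgB; [exact: cvg_cst|exact: cvg_fst].
- by apply: cvgB; [exact: cvg_cst|exact: cvg_snd].
Qed.

Lemma near_pt x t : 0 < t -> \forall x' \near x, normc (pt x - pt x') < t.
Proof.
move=> t0; have := @normc_pt_continuous (pt x) x.
move=> /cvgrPdist_lt/(_ t t0); rewrite subrr normc0; apply: filterS => x'.
by rewrite sub0r normrN; apply: le_lt_trans; exact: ler_norm.
Qed.

Lemma measurable_normc (f : plane R -> R[i]) A :
  measurable_fun A (fun p => complex.Re (f p)) ->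
  measurable_fun A (fun p => complex.Im (f p)) ->
  measurable_fun A (fun p => normc (f p)).
Proof.
move=> mr mi; have -> : (fun p => normc (f p)) =
    (fun p => Num.sqrt (complex.Re (f p) ^+ 2 + complex.Im (f p) ^+ 2)).
  by apply/funext => p; case: (f p).
apply: measurableT_comp.
  by apply: continuous_measurable_fun; exact: sqrt_continuous.
by apply: measurable_funD; apply: measurable_funX.
Qed.

(** * Integrability of the inverse distance *)
Lemma measurable_inv_dist z : measurable_fun setT (fun p => (normc (z - pt p))^-1).
Proof.
apply: measurableT_comp; first exact: measurable_inv.
exact: continuous_plane_measurable (@normc_pt_continuous z).
Qed.

Lemma dyadic_shell (t : R) : 0 < t <= 1 -> exists k, t <= 2^-1 ^+ k /\ t^-1 <= 2 ^+ k.+1.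
Proof.
move=> /andP[t0 t1].
have [|n] := @expr_small R 2^-1 t _ t0; first by apply/andP; split; lra.
elim: n => [|n IH]; first by rewrite expr0; lra.
have [h _|h h'] := ltP (2^-1 ^+ n) t; first exact: IH.
 exists n; split => //.
move: h'; rewrite -(invrK t) exprVn ltf_pV2 ?posrE ?exprn_gt0 ?invr_gt0//.
by rewrite invrK => /ltW.
Qed.

Lemma square_normc z (s : R) p : normc (z - pt p) <= s ->
  square (complex.Re z) (complex.Im z) s p.
Proof.
move=> h; have := le_trans (Re_le_normc _) h; have := le_trans (Im_le_normc _) h.
case: z p {h} => [a b] [x y] /= /ler_normlP[h1 h2] /ler_normlP[h3 h4].
by split; rewrite /= in_itv /=; apply/andP; split; lra.
Qed.

(** Dyadic squares replace polar coordinates.  Points at distance between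
[rho / 2^(k+1)] and [rho / 2^k] lie in a square of area [4 rho^2 / 4^k], on
which the integrand is at most [2^(k+1) / rho]; the products sum to [16 rho].
The convention [0^-1 = 0] makes the centre harmless. *)
Lemma integral_inv_dist_near z (rho : R) (S : set (plane R)) : 0 < rho -> measurable S ->
  (forall p, S p -> normc (z - pt p) <= rho) ->
  (\int[area]_(p in S) ((normc (z - pt p))^-1)%:E <= (16 * rho)%:E)%E.
Proof.
move=> r0 mS Sr.
pose c k : R := 2 ^+ k.+1 / rho.
pose B k := square (complex.Re z) (complex.Im z) (rho * 2^-1 ^+ k).
pose f k p : \bar R := (c k * \1_(B k) p)%:E.
have c0 k : 0 <= c k by rewrite divr_ge0// ?exprn_ge0// ltW.
have f0 k p : (0 <= f k p)%E by rewrite lee_fin mulr_ge0.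
have mf k : measurable_fun S (fun p => f k p).
  apply/measurable_EFinP; apply: measurable_funM => //.
  apply: measurable_indic; exact: measurable_square.
apply: (@le_trans _ _ (\int[area]_(p in S) \sum_(k <oo) f k p)%E).
  apply: ge0_le_integral => //.
  - by move=> p _; rewrite lee_fin invr_ge0 normc_ge0.
  - apply/measurable_EFinP; apply: measurable_funTS; exact: measurable_inv_dist.
  - exact: ge0_emeasurable_sum.
  move=> p Sp; have [w0|wn0] := eqVneq (normc (z - pt p)) 0.
    by rewrite w0 invr0 nneseries_ge0.
  have w0 : 0 < normc (z - pt p) by rewrite lt_def wn0 normc_ge0.
  have [|k [k1 k2]] := @dyadic_shell (normc (z - pt p) / rho).
    by rewrite divr_gt0//= ler_pdivrMr// mul1r Sr.
  apply: (@le_trans _ _ (f k p)).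
    rewrite /f indicE mem_set ?mulr1.
      rewrite lee_fin /c ler_pdivlMr// mulrC.
      by move: k2; rewrite invf_div.
    move: k1; rewrite ler_pdivrMr// mulrC => k1.
    exact: square_normc.
  apply: le_trans (nneseries_lim_ge k.+1 _); last by [].
  by rewrite big_nat_recr//= leeDr// sume_ge0.
rewrite integral_nneseries//.
apply: le_trans (epsilon_trick0 xpredT _); last by rewrite mulr_ge0// ltW.
apply: lee_nneseries => [k _ _|k _]; first exact: integral_ge0.
rewrite /f.
under eq_integral do rewrite EFinM.
rewrite ge0_integralZl_EFin//; last first.
  apply/measurable_EFinP; apply: measurable_indic; exact: measurable_square.
rewrite integral_indic//; last exact: measurable_square.
apply: (@le_trans _ _ ((c k)%:E * area (B k))%E).
  rewrite lee_wpmul2l ?lee_fin// le_measure ?inE//; last exact: measurable_square.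
  by apply: measurableI => //; exact: measurable_square.
rewrite area_square; last by rewrite mulr_ge0 ?exprn_ge0 ?ltW.
rewrite -EFinM lee_fin /c natrX.
have h2 : 2 ^+ k.+1 != 0 :> R by rewrite expf_neq0.
rewrite exprVn exprS invfM.
have h : 2 ^+ k != 0 :> R by rewrite expf_neq0.
have r00 : rho != 0 by rewrite gt_eqF.
rewrite le_eqVlt; apply/orP; left; apply/eqP.
by field; rewrite ?h ?r00.
Qed.

(** Splitting at distance [rho]: the integral over a set of small area is small
whatever the position of the pole [z], by choosing first [rho] and then the
area. *)
Lemma integral_inv_dist z (rho : R) (S : set (plane R)) : 0 < rho -> measurable S ->
  (\int[area]_(p in S) ((normc (z - pt p))^-1)%:E <=
    (16 * rho)%:E + (rho^-1)%:E * area S)%E.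
Proof.
move=> r0 mS.
pose A := [set p | normc (z - pt p) <= rho].
have mA : measurable A.
  have := continuous_plane_measurable (@normc_pt_continuous z).
  move=> /(_ measurableT [set` `]-oo, rho]] (measurable_itv _)); rewrite setTI.
  by congr measurable; apply/seteqP; split => p /=; rewrite in_itv.
have mE (B : set (plane R)) : measurable_fun B (fun p => ((normc (z - pt p))^-1)%:E).
  apply/measurable_EFinP; apply: measurable_funTS; exact: measurable_inv_dist.
have pos p : (0 <= ((normc (z - pt p))^-1)%:E)%E.
  by rewrite lee_fin invr_ge0 normc_ge0.
rewrite -[X in integral _ X _](setIT S) -(setUv A) setIUr ge0_integral_setU//; last 3 first.
- exact: measurableI.
- by apply: measurableI => //; exact: measurableC.
- by apply/disj_setPS => p [[_ h1] [_ h2]].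
apply: leeD.
  by apply: integral_inv_dist_near => //; [exact: measurableI|move=> p []].
apply: (@le_trans _ _ (\int[area]_(p in S `&` ~` A) (rho^-1)%:E)%E).
  apply: ge0_le_integral => //.
  - by apply: measurableI => //; exact: measurableC.
  - move=> p [_ /negP]; rewrite -ltNge => h; rewrite lee_fin lef_pV2 ?posrE ?ltW//.
    exact: lt_trans h.
rewrite integral_cst; last by apply: measurableI => //; exact: measurableC.
rewrite lee_wpmul2l ?lee_fin ?invr_ge0 ?(ltW r0)//; apply: le_measure; rewrite ?inE//.
by apply: measurableI => //; exact: measurableC.
Qed.

(** * Divergence theorem on a square *)
Section DivergenceTheorem.
Variables (a b L : R).
Hypothesis L0 : 0 < L.
Let Q := square a b L.

Lemma continuous_square_integrable (f : plane R -> R) : continuous f ->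
  area.-integrable Q (EFin \o f).
Proof.
move=> cf; apply: measurable_bounded_integrable.
- exact: measurable_square.
- exact: area_square_fin.
- by apply: measurable_funTS; exact: continuous_plane_measurable.
- have /compact_bounded[M [_ Mf]] := continuous_compact
    (continuous_subspaceT cf) (@compact_square a b L).
  by exists M; split; rewrite ?num_real// => u v p Qp; apply: Mf => //; exists p.
Qed.

Lemma FTC_vanishing (c : R) (f F : R -> R) : continuous f ->
  (forall x : R, is_derive x (1 : R) F (f x)) -> F (c - L) = 0 -> F (c + L) = 0 ->
  (\int[@lebesgue_measure R]_(x in `[(c - L)%R, (c + L)%R]) (f x)%:E = 0)%E.
Proof.
move=> cf dF Fl Fr.
have dF' x : derivable F x 1 by case: (dF x).
have cF : continuous F.
  by move=> x; apply: differentiable_continuous; apply/derivable1_diffP.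
rewrite (@continuous_FTC2 _ f F); first by rewrite Fl Fr subee.
- by move: L0; lra.
- exact: continuous_subspaceT.
- split => //; first by apply: cvg_at_right_filter; exact: cF.
  by apply: cvg_at_left_filter; exact: cF.
- by move=> x _; rewrite derive1E; case: (dF x).
Qed.

(** Fubini, with the fundamental theorem of calculus on horizontal segments. *)
Lemma integral_dx (v v' : R -> R -> R) :
  (forall x y : R, is_derive x (1 : R) (fun t => v t y) (v' x y)) ->
  continuous (fun p => v' p.1 p.2) ->
  (forall y, v (a - L) y = 0) -> (forall y, v (a + L) y = 0) ->
  \int[area]_(p in Q) v' p.1 p.2 = 0.
Proof.
move=> dv cv' vl vr; rewrite /Rintegral integral_mkcond.
pose f : plane R -> \bar R := ((fun p => (v' p.1 p.2)%:E) \_ Q).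
have fi : area.-integrable setT f.
  apply/(integrable_mkcond _ (measurable_square a b L)).
  exact: continuous_square_integrable cv'.
rewrite [X in fine X](_ : _ = (\int[@lebesgue_measure R \x @lebesgue_measure R]_p f p)%E)//.
rewrite -integral21_prod_meas1//; rewrite integral0_eq// => y _.
rewrite /fubini_G.
have [yb|yb] := boolP (y \in `[b - L, b + L]); last first.
  apply: integral0_eq => x _; rewrite /f patchE ifF//.
  by apply/negbTE; rewrite notin_setE => -[_ /=]; apply/negP.
rewrite -(@FTC_vanishing a (fun x => v' x y) (fun x => v x y))//; last first.
  move=> x; apply: (@continuous_comp _ _ _ (fun x : R => (x, y : R)) (fun p => v' p.1 p.2)).
    by apply: (@cvg_pair _ _ _ (nbhs x) (nbhs x) (nbhs (y : R))); [exact: cvg_id|exact: cvg_cst].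
  exact: cv'.
rewrite [RHS]integral_mkcond; apply: eq_integral => x _.
rewrite /f !patchE; congr (if _ then _ else _).
apply/idP/idP; rewrite !inE; first by case.
by move=> h; split.
Qed.

Lemma integral_dy (v v' : R -> R -> R) :
  (forall x y : R, is_derive y (1 : R) (fun t => v x t) (v' x y)) ->
  continuous (fun p => v' p.1 p.2) ->
  (forall x, v x (b - L) = 0) -> (forall x, v x (b + L) = 0) ->
  \int[area]_(p in Q) v' p.1 p.2 = 0.
Proof.
move=> dv cv' vl vr; rewrite /Rintegral integral_mkcond.
pose f : plane R -> \bar R := ((fun p => (v' p.1 p.2)%:E) \_ Q).
have fi : area.-integrable setT f.
  apply/(integrable_mkcond _ (measurable_square a b L)).
  exact: continuous_square_integrable cv'.
rewrite [X in fine X](_ : _ = (\int[@lebesgue_measure R \x @lebesgue_measure R]_p f p)%E)//.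
rewrite -integral12_prod_meas1//; rewrite integral0_eq// => x _.
rewrite /fubini_F.
have [yb|yb] := boolP (x \in `[a - L, a + L]); last first.
  apply: integral0_eq => y _; rewrite /f patchE ifF//.
  by apply/negbTE; rewrite notin_setE => -[/= h _]; move: h; apply/negP.
rewrite -(@FTC_vanishing b (fun y => v' x y) (fun y => v x y))//; last first.
  move=> y; apply: (@continuous_comp _ _ _ (fun y : R => (x : R, y)) (fun p => v' p.1 p.2)).
    by apply: (@cvg_pair _ _ _ (nbhs y) (nbhs (x : R)) (nbhs y)); [exact: cvg_cst|exact: cvg_id].
  exact: cv'.
rewrite [RHS]integral_mkcond; apply: eq_integral => y _.
rewrite /f !patchE; congr (if _ then _ else _).
apply/idP/idP; rewrite !inE; first by case.
by move=> h; split.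
Qed.

End DivergenceTheorem.

(** * Integrals of bounded complex functions *)
Section ComplexIntegral.
Variable Q : set (plane R).
Hypotheses (mQ : measurable Q) (fQ : (area Q < +oo)%E).
Implicit Types f g : plane R -> R[i].

Definition bmeas f := [/\ measurable_fun setT (fun p => complex.Re (f p)),
  measurable_fun setT (fun p => complex.Im (f p))
  & exists M : R, forall p, Q p -> normc (f p) <= M].

Definition Cint f : R[i] :=
  (\int[area]_(p in Q) complex.Re (f p)) +i* (\int[area]_(p in Q) complex.Im (f p)).

Lemma bmeas_real (u : plane R -> R) (M : R) : measurable_fun setT u ->
  (forall p, Q p -> `|u p| <= M) -> bmeas (fun p => (u p)%:C).
Proof.
move=> mu bu; split => //; exists M => p Qp; rewrite normcR; exact: bu.
Qed.

Lemma bmeas_cst c : bmeas (fun=> c).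
Proof. by split=> //; exists (normc c). Qed.

Lemma bmeasD f g : bmeas f -> bmeas g -> bmeas (fun p => f p + g p).
Proof.
move=> [rf jf [M Mf]] [rg jg [N Ng]]; split.
- by under eq_fun do rewrite raddfD; exact: measurable_funD.
- by under eq_fun do rewrite raddfD; exact: measurable_funD.
- exists (M + N) => p Qp; rewrite (le_trans (le_normcD _ _))// lerD//; [exact: Mf|exact: Ng].
Qed.

Lemma bmeasM f g : bmeas f -> bmeas g -> bmeas (fun p => f p * g p).
Proof.
move=> [rf jf [M Mf]] [rg jg [N Ng]]; split.
- by under eq_fun do rewrite Re_mulc; apply: measurable_funB; exact: measurable_funM.
- by under eq_fun do rewrite Im_mulc; apply: measurable_funD; exact: measurable_funM.
- exists (M * N) => p Qp; rewrite normcM ler_pM ?normc_ge0//; [exact: Mf|exact: Ng].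
Qed.

Lemma bmeas_indic A : measurable A -> bmeas (fun p => (\1_A p)%:C).
Proof.
move=> mA; apply: (@bmeas_real _ 1); first exact: measurable_indic.
by move=> p _; rewrite indicE; case: (_ \in _); rewrite ?normr1// normr0.
Qed.

Lemma bmeas_integrable f : bmeas f ->
  area.-integrable Q (EFin \o (fun p => complex.Re (f p))) /\
  area.-integrable Q (EFin \o (fun p => complex.Im (f p))).
Proof.
move=> [rf jf [M Mf]]; split; apply: measurable_bounded_integrable => //.
- exact: measurable_funTS.
- exists M; split; rewrite ?num_real// => N MN p Qp /=.
  by rewrite (le_trans (Re_le_normc _))// (le_trans (Mf _ Qp))// ltW.
- exact: measurable_funTS.
- exists M; split; rewrite ?num_real// => N MN p Qp /=.
  by rewrite (le_trans (Im_le_normc _))// (le_trans (Mf _ Qp))// ltW.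
Qed.

Lemma CintD f g : bmeas f -> bmeas g -> Cint (fun p => f p + g p) = Cint f + Cint g.
Proof.
move=> /bmeas_integrable[rf jf] /bmeas_integrable[rg jg]; rewrite /Cint.
under eq_Rintegral do rewrite raddfD.
rewrite RintegralD//.
under [X in _ +i* X = _]eq_Rintegral do rewrite raddfD.
by rewrite RintegralD.
Qed.

Lemma CintZ c f : bmeas f -> Cint (fun p => c * f p) = c * Cint f.
Proof.
move=> /bmeas_integrable[rf jf]; rewrite /Cint; apply/eqP; rewrite eq_complex /=.
have iZ k (u : plane R -> R) : area.-integrable Q (EFin \o u) ->
    area.-integrable Q (EFin \o (fun p => k * u p)).
  by move=> iu; exact: (integrableZl mQ k iu).
under eq_Rintegral do rewrite Re_mulc.
under [X in _ && (X == _)]eq_Rintegral do rewrite Im_mulc.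
rewrite RintegralB ?RintegralD//; [|exact: iZ..].
by rewrite !RintegralZl// !Re_mulc !Im_mulc /= !eqxx.
Qed.

Lemma Rintegral_normr_le (u k : plane R -> R) (e : R) : measurable_fun setT u ->
  area.-integrable Q (EFin \o u) -> measurable_fun setT k ->
  (forall p, Q p -> `|u p| <= k p) ->
  (\int[area]_(p in Q) (k p)%:E <= e%:E)%E -> `|\int[area]_(p in Q) u p| <= e.
Proof.
move=> mu iu mk uk ke; rewrite -lee_fin EFin_normr_Rintegral//; apply: le_trans ke.
apply: le_trans (le_abse_integral _ _ _) _ => //.
  by apply/measurable_EFinP; exact: measurable_funTS.
apply: ge0_le_integral => //.
- by apply/measurable_EFinP; apply: measurableT_comp => //; exact: measurable_funTS.
- by apply/measurable_EFinP; exact: measurable_funTS.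
Qed.

(** The factor 2 comes from estimating real and imaginary parts separately. *)
Lemma Cint_le f (k : plane R -> R) (e : R) : bmeas f -> measurable_fun setT k ->
  (forall p, Q p -> normc (f p) <= k p) ->
  (\int[area]_(p in Q) (k p)%:E <= e%:E)%E -> normc (Cint f) <= 2 * e.
Proof.
move=> bf mk fk ke; have [rf jf] := bmeas_integrable bf.
have [mr mj _] := bf.
rewrite (le_trans (normc_le_ReIm _))//= mulr2n mulrDl !mul1r lerD//.
  apply: (Rintegral_normr_le mr rf mk _ ke) => p Qp.
  exact: le_trans (Re_le_normc _) (fk _ Qp).
apply: (Rintegral_normr_le mj jf mk _ ke) => p Qp.
exact: le_trans (Im_le_normc _) (fk _ Qp).
Qed.

End ComplexIntegral.

End PlaneMeasure.

Lemma bmeas_continuous (R : realType) (a b L : R) (u v : R * R -> R) :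
  continuous u -> continuous v -> bmeas (square a b L) (fun p => u p +i* v p).
Proof.
have bd (w : R * R -> R) : continuous w -> exists M : R, forall p, square a b L p -> `|w p| <= M.
  move=> cw; have /compact_bounded[M [_ Mf]] := continuous_compact
    (continuous_subspaceT cw) (@compact_square R a b L).
  exists (`|M| + 1) => p Qp; apply: Mf; last by exists p.
  by rewrite (le_lt_trans (ler_norm _))// ltrDl.
move=> cu cv; have [M hM] := bd u cu; have [M' hM'] := bd v cv.
split.
- exact: continuous_plane_measurable.
- exact: continuous_plane_measurable.
- exists (M + M') => p Qp; rewrite (le_trans (normc_le_ReIm _))//.
  by apply: lerD; [exact: hM|exact: hM'].
Qed.

(** * The regularised Cauchy-Pompeiu formula *)
Section Continuity.
Variables (R : realType) (T : topologicalType).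
Implicit Types f g : T -> R.

Lemma contD f g : continuous f -> continuous g -> continuous (fun t => f t + g t).
Proof. by move=> cf cg t; apply: cvgD; [exact: cf|exact: cg]. Qed.

Lemma contN f : continuous f -> continuous (fun t => - f t).
Proof. by move=> cf t; apply: cvgN; exact: cf. Qed.

Lemma contM f g : continuous f -> continuous g -> continuous (fun t => f t * g t).
Proof. by move=> cf cg t; apply: cvgM; [exact: cf|exact: cg]. Qed.

Lemma contV f : (forall t, f t != 0) -> continuous f -> continuous (fun t => (f t)^-1).
Proof. by move=> f0 cf t; apply: continuousV => //; exact: cf. Qed.

Lemma contC (c : R) : continuous (fun _ : T => c).
Proof. by move=> t; exact: cvg_cst. Qed.

Lemma cont_comp (h : R -> R) f : continuous h -> continuous f -> continuous (fun t => h (f t)).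
Proof. by move=> ch cf t; apply: continuous_comp; [exact: cf|exact: ch]. Qed.

End Continuity.

Section CauchyKernel.
Variable R : realType.

(** [1 / w] without its singularity; it tends to [1 / w] as [e] tends to 0. *)
Definition reg_cauchy (e : R) (w : R[i]) : R[i] := conjc w * ((normc w ^+ 2 + e)^-1)%:C.

(** The derivative of [reg_cauchy e w] with respect to the conjugate of [w]; it
concentrates at 0 as [e] tends to 0. *)
Definition mollifier (e : R) (w : R[i]) : R := e * (normc w ^+ 2 + e)^-1 ^+ 2.

Lemma reg_cauchy_err (e : R) (w : R[i]) : 0 < e ->
  normc (reg_cauchy e w - w^-1) <= (e / (normc w ^+ 2 + e)) * (normc w)^-1.
Proof.
move=> e0; have [->|w0] := eqVneq w 0.
  by rewrite /reg_cauchy conjc0 mul0r invr0 subrr normc0 invr0 mulr0.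
have n0 : 0 < normc w ^+ 2 + e by rewrite ltr_wpDl ?sqr_ge0.
have wE : conjc w = (normc w ^+ 2)%:C * w^-1.
  have -> : (normc w ^+ 2)%:C = w * conjc w.
    rewrite normc_sqr; case: (w) => x y /=; apply/eqP; rewrite eq_complex /=.
    by apply/andP; split; apply/eqP; ring.
  by rewrite mulrAC divff// mul1r.
have -> : reg_cauchy e w - w^-1 = ((normc w ^+ 2) / (normc w ^+ 2 + e) - 1)%:C * w^-1.
  by rewrite /reg_cauchy wE !rmorphB !rmorphM /=; ring.
rewrite normcM normcV ler_wpM2r ?invr_ge0 ?normc_ge0// normcR.
have -> : normc w ^+ 2 / (normc w ^+ 2 + e) - 1 = - (e / (normc w ^+ 2 + e)).
  by field; rewrite gt_eqF.
by rewrite normrN ger0_norm// divr_ge0// ltW.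
Qed.

Lemma normc_reg_cauchy (e : R) (w : R[i]) : 0 < e ->
  normc (reg_cauchy e w) <= (normc w)^-1.
Proof.
move=> e0; have [->|w0] := eqVneq w 0.
  by rewrite /reg_cauchy conjc0 mul0r normc0 invr0.
have n0 : 0 < normc w ^+ 2 + e by rewrite ltr_wpDl ?sqr_ge0.
have nw : 0 < normc w by rewrite normc_gt0.
rewrite /reg_cauchy normcM normcR ger0_norm ?invr_ge0 ?(ltW n0)//.
have -> : normc (conjc w) = normc w by case: (w) => x y; rewrite /normc /= sqrrN.
rewrite ler_pdivrMr// mulrC ler_pdivlMr// -expr2; lra.
Qed.

Lemma mollifier_continuous (e : R) z : 0 < e -> continuous (fun p : R * R => mollifier e (z - pt p)).
Proof.
move=> e0; have cn := @normc_pt_continuous R z.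
have cq : continuous (fun p : R * R => (normc (z - pt p) ^+ 2 + e)^-1).
  apply: contV => [p|]; first by rewrite gt_eqF// ltr_wpDl ?sqr_ge0.
  exact: contD (contM cn cn) (@contC _ _ e).
exact: contM (@contC _ _ e) (contM cq cq).
Qed.

Lemma derivative_continuous (f f' : R -> R) :
  (forall x : R, is_derive x (1 : R) f (f' x)) -> continuous f.
Proof.
move=> df x; apply: differentiable_continuous; apply/derivable1_diffP.
by case: (df x).
Qed.

Lemma is_derive_inv_sqr (c p x : R) : 0 < c ->
  is_derive x (1 : R) (fun t : R => ((p - t) ^+ 2 + c)^-1)
    (2 * (p - x) * ((p - x) ^+ 2 + c)^-1 ^+ 2).
Proof.
move=> c0.
have n0 t : (p - t) ^+ 2 + c != 0 by rewrite gt_eqF// ltr_wpDl// sqr_ge0.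
have d1 : is_derive x (1 : R) (fun t : R => (p - t) ^+ 2 + c) (- (2 * (p - x))).
  by apply: is_derive_eq; rewrite /GRing.scale /=; ring.
have := @is_deriveV R (fun t => (p - t) ^+ 2 + c) x (- (2 * (p - x))) 1 (n0 x) d1.
move=> h; apply: is_derive_eq h _.
by rewrite /GRing.scale /= exprVn; ring.
Qed.

Variables (a b L : R) (P P' S S' : R -> R).
Hypotheses (L0 : 0 < L) (dP : forall x : R, is_derive x (1 : R) P (P' x))
  (dS : forall x : R, is_derive x (1 : R) S (S' x))
  (cP' : continuous P') (cS' : continuous S')
  (Pl : P (a - L) = 0) (Pr : P (a + L) = 0) (Sl : S (b - L) = 0) (Sr : S (b + L) = 0).

Variables (p q e : R).
Hypothesis e0 : 0 < e.

Let f (x y : R) : R := ((p - x) ^+ 2 + ((q - y) ^+ 2 + e))^-1.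

Let fx x y : is_derive x (1 : R) (fun t : R => f t y) (2 * (p - x) * f x y ^+ 2).
Proof. by apply: is_derive_inv_sqr; rewrite ltr_wpDl// sqr_ge0. Qed.

Let fy x y : is_derive y (1 : R) (fun t : R => f x t) (2 * (q - y) * f x y ^+ 2).
Proof.
have -> : (fun t => f x t) = (fun t => ((q - t) ^+ 2 + ((p - x) ^+ 2 + e))^-1).
  by apply/funext => t; rewrite /f addrCA.
have -> : f x y = ((q - y) ^+ 2 + ((p - x) ^+ 2 + e))^-1 by rewrite /f addrCA.
by apply: is_derive_inv_sqr; rewrite ltr_wpDl// sqr_ge0.
Qed.

Let c1 : continuous (fun z : R * R => z.1). Proof. by move=> z; exact: cvg_fst. Qed.
Let c2 : continuous (fun z : R * R => z.2). Proof. by move=> z; exact: cvg_snd. Qed.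
Let cP := derivative_continuous dP.
Let cS := derivative_continuous dS.
Let cw1 : continuous (fun z : R * R => p - z.1).
Proof. by apply: contD; [exact: contC|exact: contN]. Qed.
Let cw2 : continuous (fun z : R * R => q - z.2).
Proof. by apply: contD; [exact: contC|exact: contN]. Qed.
Let cf : continuous (fun z : R * R => f z.1 z.2).
Proof.
apply: contV => [z|]; first by rewrite gt_eqF// addrA ltr_wpDl// addr_ge0 ?sqr_ge0.
by apply: contD; [exact: contM|apply: contD; [exact: contM|exact: contC]].
Qed.
Let cP1 : continuous (fun z : R * R => P z.1). Proof. exact: cont_comp. Qed.
Let cP'1 : continuous (fun z : R * R => P' z.1). Proof. exact: cont_comp. Qed.
Let cS2 : continuous (fun z : R * R => S z.2). Proof. exact: cont_comp. Qed.
Let cS'2 : continuous (fun z : R * R => S' z.2). Proof. exact: cont_comp. Qed.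

Let Q := square a b L.
Let mQ : measurable Q. Proof. exact: measurable_square. Qed.

Let cff : continuous (fun z : R * R => f z.1 z.2 * f z.1 z.2).
Proof. exact: contM cf cf. Qed.
Let cg : continuous (fun z : R * R => P z.1 * S z.2).
Proof. exact: contM cP1 cS2. Qed.
Let ci1 : continuous (fun z : R * R => P' z.1 * S z.2 * (p - z.1) * f z.1 z.2 +
   P z.1 * S z.2 * (- f z.1 z.2 + (p - z.1) * (2 * (p - z.1) * (f z.1 z.2 * f z.1 z.2)))).
Proof.
exact: (contD (contM (contM (contM cP'1 cS2) cw1) cf)
  (contM cg (contD (contN cf) (contM cw1 (contM (contM (@contC _ _ 2) cw1) cff))))).
Qed.
Let ci2 : continuous (fun z : R * R => P z.1 * S' z.2 * (q - z.2) * f z.1 z.2 +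
   P z.1 * S z.2 * (- f z.1 z.2 + (q - z.2) * (2 * (q - z.2) * (f z.1 z.2 * f z.1 z.2)))).
Proof.
exact: (contD (contM (contM (contM cP1 cS'2) cw2) cf)
  (contM cg (contD (contN cf) (contM cw2 (contM (contM (@contC _ _ 2) cw2) cff))))).
Qed.
Let ci3 : continuous (fun z : R * R => P' z.1 * S z.2 * (q - z.2) * f z.1 z.2 +
   P z.1 * S z.2 * ((q - z.2) * (2 * (p - z.1) * (f z.1 z.2 * f z.1 z.2)))).
Proof.
exact: (contD (contM (contM (contM cP'1 cS2) cw2) cf)
  (contM cg (contM cw2 (contM (contM (@contC _ _ 2) cw1) cff)))).
Qed.
Let ci4 : continuous (fun z : R * R => P z.1 * S' z.2 * (p - z.1) * f z.1 z.2 +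
   P z.1 * S z.2 * ((p - z.1) * (2 * (q - z.2) * (f z.1 z.2 * f z.1 z.2)))).
Proof.
exact: (contD (contM (contM (contM cP1 cS'2) cw1) cf)
  (contM cg (contM cw1 (contM (contM (@contC _ _ 2) cw2) cff)))).
Qed.
Let cX : continuous (fun z : R * R =>
   (P' z.1 * S z.2 * (p - z.1) + P z.1 * S' z.2 * (q - z.2)) * f z.1 z.2).
Proof.
exact: (contM (contD (contM (contM cP'1 cS2) cw1) (contM (contM cP1 cS'2) cw2)) cf).
Qed.
Let cD0 : continuous (fun z : R * R => P z.1 * S z.2 * (e * (f z.1 z.2 * f z.1 z.2))).
Proof. exact: (contM cg (contM (@contC _ _ e) cff)). Qed.

(* With [g = P(x) S(y)] and the vector field [w / (|w|^2 + e)], the gradient of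
   [- log (|w|^2 + e) / 2], [I1] and [I2] integrate the two parts of the
   divergence of [g] times the field, [I3] and [I4] those of its curl. *)
Let I1 : \int[@area R]_(z in Q)
  (P' z.1 * S z.2 * (p - z.1) * f z.1 z.2 +
   P z.1 * S z.2 * (- f z.1 z.2 + (p - z.1) * (2 * (p - z.1) * (f z.1 z.2 * f z.1 z.2)))) = 0.
Proof.
apply: (@integral_dx _ a b L L0 (fun x y => P x * S y * (p - x) * f x y)
  (fun x y => P' x * S y * (p - x) * f x y +
   P x * S y * (- f x y + (p - x) * (2 * (p - x) * (f x y * f x y))))).
- move=> x y; have := fx x y; have := dP x => h1 h2.
  by apply: is_derive_eq; rewrite /GRing.scale /=; ring.
- exact: ci1.
- by move=> y; rewrite Pl !mul0r.
- by move=> y; rewrite Pr !mul0r.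
Qed.

Let I2 : \int[@area R]_(z in Q)
  (P z.1 * S' z.2 * (q - z.2) * f z.1 z.2 +
   P z.1 * S z.2 * (- f z.1 z.2 + (q - z.2) * (2 * (q - z.2) * (f z.1 z.2 * f z.1 z.2)))) = 0.
Proof.
apply: (@integral_dy _ a b L L0 (fun x y => P x * S y * (q - y) * f x y)
  (fun x y => P x * S' y * (q - y) * f x y +
   P x * S y * (- f x y + (q - y) * (2 * (q - y) * (f x y * f x y))))).
- move=> x y; have := fy x y; have := dS y => h1 h2.
  by apply: is_derive_eq; rewrite /GRing.scale /=; ring.
- exact: ci2.
- by move=> y; rewrite Sl !(mul0r, mulr0).
- by move=> y; rewrite Sr !(mul0r, mulr0).
Qed.

Let I3 : \int[@area R]_(z in Q)
  (P' z.1 * S z.2 * (q - z.2) * f z.1 z.2 +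
   P z.1 * S z.2 * ((q - z.2) * (2 * (p - z.1) * (f z.1 z.2 * f z.1 z.2)))) = 0.
Proof.
apply: (@integral_dx _ a b L L0 (fun x y => P x * S y * (q - y) * f x y)
  (fun x y => P' x * S y * (q - y) * f x y +
   P x * S y * ((q - y) * (2 * (p - x) * (f x y * f x y))))).
- move=> x y; have := fx x y; have := dP x => h1 h2.
  by apply: is_derive_eq; rewrite /GRing.scale /=; ring.
- exact: ci3.
- by move=> y; rewrite Pl !mul0r.
- by move=> y; rewrite Pr !mul0r.
Qed.

Let I4 : \int[@area R]_(z in Q)
  (P z.1 * S' z.2 * (p - z.1) * f z.1 z.2 +
   P z.1 * S z.2 * ((p - z.1) * (2 * (q - z.2) * (f z.1 z.2 * f z.1 z.2)))) = 0.
Proof.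
apply: (@integral_dy _ a b L L0 (fun x y => P x * S y * (p - x) * f x y)
  (fun x y => P x * S' y * (p - x) * f x y +
   P x * S y * ((p - x) * (2 * (q - y) * (f x y * f x y))))).
- move=> x y; have := fy x y; have := dS y => h1 h2.
  by apply: is_derive_eq; rewrite /GRing.scale /=; ring.
- exact: ci4.
- by move=> y; rewrite Sl !(mul0r, mulr0).
- by move=> y; rewrite Sr !(mul0r, mulr0).
Qed.

(** Real part: integration by parts against the divergence of the field, which
is, up to sign, twice the mollifier.  Imaginary part: the field is a gradient,
so it has no curl and integration by parts leaves nothing. *)
Lemma cauchy_pompeiu_reg :
  Cint Q (fun z => (P' z.1 * S z.2 +i* (P z.1 * S' z.2)) * reg_cauchy e ((p +i* q) - pt z)) =
  (2 * \int[@area R]_(z in Q) (P z.1 * S z.2 * mollifier e ((p +i* q) - pt z)))%:C.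
Proof.
have fE (z : R * R) : (normc ((p +i* q) - pt z) ^+ 2 + e)^-1 = f z.1 z.2.
  by rewrite normc_sqr /f addrA.
have iQ (u : R * R -> R) : continuous u -> (area R).-integrable Q (EFin \o u).
  exact: continuous_square_integrable.
pose D (z : R * R) := P z.1 * S z.2 * (e * (f z.1 z.2 * f z.1 z.2)).
pose X (z : R * R) := (P' z.1 * S z.2 * (p - z.1) + P z.1 * S' z.2 * (q - z.2)) * f z.1 z.2.
have iD : (area R).-integrable Q (EFin \o D) by exact: iQ cD0.
have iX : (area R).-integrable Q (EFin \o X) by exact: iQ cX.
rewrite /Cint /real_complex_def; congr Complex.
  transitivity (\int[area R]_(z in Q) X z).
    apply: eq_Rintegral => z _; rewrite /reg_cauchy fE Re_mulc /X.
    by case: z => x y /=; ring.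
  transitivity (2 * \int[area R]_(z in Q) D z); last first.
    by congr (2 * _); apply: eq_Rintegral => z _; rewrite /mollifier fE expr2.
  have iD2 : (area R).-integrable Q (EFin \o (fun z => 2 * D z)).
    by apply: iQ; exact: contM (@contC _ _ 2) cD0.
  rewrite -RintegralZl//; apply/eqP; rewrite -subr_eq0 -RintegralB//.
  have i1 := iQ _ ci1; have i2 := iQ _ ci2.
  rewrite -[X in _ == X](addr0 0) -{1}I1 -I2 -RintegralD//.
  apply/eqP; apply: eq_Rintegral => z _; rewrite /X /D.
  case: z => x y /=.
  have E : f x y = f x y * f x y * ((p - x) ^+ 2 + ((q - y) ^+ 2 + e)).
    rewrite -mulrA mulVf ?mulr1// gt_eqF// addrA ltr_wpDl// addr_ge0 ?sqr_ge0//.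
  have -> : - f x y = - (f x y * f x y * ((p - x) ^+ 2 + ((q - y) ^+ 2 + e))) by rewrite -E.
  by ring.
have i3 := iQ _ ci3; have i4 := iQ _ ci4.
rewrite -[RHS](subrr 0) -{1}I4 -I3 -RintegralB//.
apply: eq_Rintegral => z _; rewrite /reg_cauchy fE Im_mulc.
by case: z => x y /=; ring.
Qed.

End CauchyKernel.

(** * Uniform integrability of the Cauchy kernel *)
Section Weights.
Variables (R : realType) (Q : set (plane R)).
Hypotheses (mQ : measurable Q) (fQ : (area R Q < +oo)%E).

Definition weight (S : set (plane R)) (z : R[i]) (p : plane R) : R :=
  \1_S p * (normc (z - pt p))^-1.

Lemma weight_ge0 S z p : 0 <= weight S z p.
Proof. by rewrite mulr_ge0// invr_ge0 normc_ge0. Qed.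

Lemma measurable_weight S z : measurable S -> measurable_fun setT (weight S z).
Proof.
move=> mS; apply: measurable_funM; last exact: measurable_inv_dist.
exact: measurable_indic.
Qed.

Lemma integral_leD (f g : plane R -> R) (a b : R) :
  measurable_fun setT f -> measurable_fun setT g ->
  (forall p, 0 <= f p) -> (forall p, 0 <= g p) ->
  (\int[area R]_(p in Q) (f p)%:E <= a%:E)%E ->
  (\int[area R]_(p in Q) (g p)%:E <= b%:E)%E ->
  (\int[area R]_(p in Q) (f p + g p)%:E <= (a + b)%:E)%E.
Proof.
move=> mf mg f0 g0 fa gb.
under eq_integral do rewrite EFinD.
rewrite ge0_integralD//; first by rewrite EFinD leeD.
- by move=> p _; rewrite lee_fin.
- by apply/measurable_EFinP; exact: measurable_funTS.
- by move=> p _; rewrite lee_fin.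
- by apply/measurable_EFinP; exact: measurable_funTS.
Qed.

Lemma integral_leZ (f : plane R -> R) (k a : R) : 0 <= k ->
  measurable_fun setT f -> (forall p, 0 <= f p) ->
  (\int[area R]_(p in Q) (f p)%:E <= a%:E)%E ->
  (\int[area R]_(p in Q) (k * f p)%:E <= (k * a)%:E)%E.
Proof.
move=> k0 mf f0 fa.
under eq_integral do rewrite EFinM.
rewrite ge0_integralZl_EFin//; first by rewrite EFinM lee_wpmul2l// lee_fin.
- by move=> p _; rewrite lee_fin.
- by apply/measurable_EFinP; exact: measurable_funTS.
Qed.

Lemma integral_weight S z (rho a : R) : 0 < rho -> measurable S -> (area R S <= a%:E)%E ->
  (\int[area R]_(p in Q) (weight S z p)%:E <= (16 * rho + rho^-1 * a)%:E)%E.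
Proof.
move=> r0 mS Sa.
have -> : (\int[area R]_(p in Q) (weight S z p)%:E =
  \int[area R]_(p in Q `&` S) ((normc (z - pt p))^-1)%:E)%E.
  rewrite integral_mkcondr; apply: eq_integral => p _.
  rewrite /weight patchE indicE; case: ifP => pS; last by rewrite mul0r.
  by rewrite mul1r.
apply: le_trans (integral_inv_dist z r0 (measurableI _ _ mQ mS)) _.
rewrite EFinD [(rho^-1 * a)%:E]EFinM; apply: leeD2l.
apply: lee_wpmul2l; first by rewrite lee_fin invr_ge0 ltW.
apply: le_trans Sa; apply: le_measure; rewrite ?inE//; exact: measurableI.
Qed.

(** The point is that the bound on the area is the same for all poles [z]. *)
Lemma weight_small (t : R) : 0 < t -> exists2 a : R, 0 < a &
  forall S z, measurable S -> (area R S <= a%:E)%E ->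
    (\int[area R]_(p in Q) (weight S z p)%:E <= t%:E)%E.
Proof.
move=> t0; exists (t / 32 * (t / 2)); first by rewrite !mulr_gt0.
have s0 : 0 < t / 32 by rewrite divr_gt0.
move=> S z mS Sa; apply: le_trans (integral_weight z s0 mS Sa) _.
rewrite lee_fin [_^-1 * _]mulrA mulVf ?mul1r; last by rewrite gt_eqF.
lra.
Qed.

Lemma weight_bounded : exists2 J : R, 0 < J & forall z,
  (\int[area R]_(p in Q) (weight Q z p)%:E <= J%:E)%E.
Proof.
have fin : area R Q \is a fin_num by rewrite ge0_fin_numE.
exists (16 * 1 + 1^-1 * fine (area R Q)).
  by rewrite ltr_pwDl ?mulr_ge0 ?invr_ge0 ?ler01 ?fine_ge0//; lra.
by move=> z; apply: integral_weight; rewrite ?ltr01 ?fineK.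
Qed.

End Weights.

(** * Separable kernels *)
Section SeparableKernels.
Variables (R : realType) (Q : set (plane R)) (A : set (R[i] -> R[i])).
Hypotheses (mQ : measurable Q) (fQ : (area R Q < +oo)%E) (AA : subalg A).

(** Finite sums of products [u p * q z] with [q] in the algebra: integrating
such a kernel over [p] gives an element of the algebra itself, without a limit
being taken. *)
Inductive separable : (plane R -> R[i] -> R[i]) -> Prop :=
| separable_prod u q : bmeas Q u -> A q -> separable (fun p z => u p * q z)
| separable_add k1 k2 : separable k1 -> separable k2 ->
    separable (fun p z => k1 p z + k2 p z).

Lemma separable_bmeas k z : separable k -> bmeas Q (k ^~ z).
Proof.
elim=> [u q bu _|k1 k2 _ b1 _ b2]; first by apply: bmeasM => //; exact: bmeas_cst.
exact: bmeasD.
Qed.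

Lemma separable_Cint k : separable k -> A (fun z => Cint Q (fun p => k p z)).
Proof.
have [Ac AD AM] := AA.
elim=> [u q bu Aq|k1 k2 s1 A1 s2 A2].
  have := AM _ _ Aq (Ac (Cint Q u)); congr A; apply/funext => z.
  by rewrite -CintZ//; congr Cint; apply/funext => p; rewrite mulrC.
have := AD _ _ A1 A2; congr A; apply/funext => z.
by rewrite CintD//; exact: separable_bmeas.
Qed.

Lemma separable_mul k1 k2 : separable k1 -> separable k2 ->
  separable (fun p z => k1 p z * k2 p z).
Proof.
have [_ _ AM] := AA => s1 s2.
elim: s1 => [u q bu Aq|k k' _ s _ s'].
  elim: s2 => [u' q' bu' Aq'|l l' _ s _ s'].
    have := separable_prod (bmeasM bu bu') (AM _ _ Aq Aq'); congr separable.
    by apply/funext => p; apply/funext => z; rewrite mulrACA.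
  have := separable_add s s'; congr separable.
  by apply/funext => p; apply/funext => z; rewrite mulrDr.
have := separable_add s s'; congr separable.
by apply/funext => p; apply/funext => z; rewrite mulrDl.
Qed.

Lemma separable_fst u : bmeas Q u -> separable (fun p z => u p).
Proof.
have [Ac _ _] := AA => bu; have := separable_prod bu (Ac 1); congr separable.
by apply/funext => p; apply/funext => z; rewrite mulr1.
Qed.

Lemma separable_snd q : A q -> separable (fun p z => q z).
Proof.
move=> Aq; have := separable_prod (bmeas_cst Q 1) Aq; congr separable.
by apply/funext => p; apply/funext => z; rewrite mul1r.
Qed.

Lemma separable_poly k (s : {poly R[i]}) : separable k ->
  separable (fun p z => s.[k p z]).
Proof.
move=> sk; elim/poly_ind: s => [|s a IH].
  have := separable_fst (bmeas_cst Q 0); congr separable.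
  by apply/funext => p; apply/funext => z; rewrite horner0.
have := separable_add (separable_mul IH sk) (separable_fst (bmeas_cst Q a)).
by congr separable; apply/funext => p; apply/funext => z; rewrite !hornerE.
Qed.

End SeparableKernels.

(** * Approximating the Cauchy kernel *)
Section CauchyKernelInAlgebra.
Variables (R : realType) (c : R[i]) (r : R) (F : R[i] -> R[i]) (A : set (R[i] -> R[i])).
Hypotheses (r0 : 0 < r) (AA : subalg A) (Aid : A id) (AF : A F).

Definition disc : set R[i] := [set z | normc (z - c) <= r].
Definition plane_disc : set (plane R) := [set p | disc (pt p)].

Let D := disc.
Let D2 := plane_disc.
Let Q := square (complex.Re c) (complex.Im c) (2 * r).

Hypotheses (cFr : {within D2, continuous (fun p => complex.Re (F (pt p)))})
  (cFi : {within D2, continuous (fun p => complex.Im (F (pt p)))}).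

Let mQ : measurable Q. Proof. exact: measurable_square. Qed.
Let fQ : (area R Q < +oo)%E.
Proof. by apply: area_square_fin; rewrite mulr_gt0. Qed.

Let sub_fin S : measurable S -> S `<=` Q -> (area R S < +oo)%E.
Proof. by move=> mS SQ; apply: le_lt_trans fQ; apply: le_measure; rewrite ?inE. Qed.

Lemma plane_disc_closed : closed D2.
Proof.
have -> : D2 = (fun p => normc (c - pt p)) @^-1` [set x | x <= r].
  by apply/seteqP; split => p; rewrite /D2 /plane_disc /disc /= normcB.
apply: closed_comp; last exact: closed_le.
by move=> p _; exact: normc_pt_continuous.
Qed.

Lemma plane_disc_square : D2 `<=` Q.
Proof.
move=> p Dp; have h : normc (c - pt p) <= r by rewrite normcB.
by apply: square_normc; move: r0; lra.
Qed.

Lemma plane_disc_compact : compact D2.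
Proof.
apply: subclosed_compact plane_disc_closed (@compact_square _ _ _ _) plane_disc_square.
Qed.

Lemma plane_disc_measurable : measurable D2.
Proof. exact: closed_plane_measurable plane_disc_closed. Qed.

Lemma disc_bounded : exists2 M : R, 0 < M & forall z, D z -> normc (F z) <= M.
Proof.
have /compact_bounded[M1 [_ h1]] := continuous_compact cFr plane_disc_compact.
have /compact_bounded[M2 [_ h2]] := continuous_compact cFi plane_disc_compact.
exists (`|M1| + `|M2| + 2); first by rewrite ltr_wpDl ?addr_ge0.
move=> z Dz; rewrite (le_trans (normc_le_ReIm _))//.
have Dp : D2 (complex.Re z, complex.Im z) by rewrite /D2 /plane_disc /mkset pt_ReIm.
have -> : `|M1| + `|M2| + 2 = (`|M1| + 1) + (`|M2| + 1) by ring.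
apply: lerD.
- apply: h1; first by rewrite (le_lt_trans (ler_norm _))// ltrDl.
  by exists (complex.Re z, complex.Im z) => //; rewrite pt_ReIm.
- apply: h2; first by rewrite (le_lt_trans (ler_norm _))// ltrDl.
  by exists (complex.Re z, complex.Im z) => //; rewrite pt_ReIm.
Qed.

(* [F] is continuous on the disc only, so it is cut off before being integrated. *)
Let F1 (p : plane R) : R[i] := (\1_D2 p)%:C * F (pt p).

Lemma bmeas_F1 : bmeas Q F1.
Proof.
have h (u : plane R -> R) : {within D2, continuous u} ->
    measurable_fun setT (fun p => \1_D2 p * u p).
  move=> cu; have mu := within_continuous_measurable plane_disc_measurable cu.
  have := (measurable_restrict u plane_disc_measurable measurableT).1.
  rewrite setTI => /(_ mu); congr measurable_fun; apply/funext => p.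
  by rewrite patchE indicE; case: ifP => _; rewrite ?mul1r ?mul0r.
have [M M0 FM] := disc_bounded.
split.
- have := h _ cFr; congr measurable_fun; apply/funext => p.
  by rewrite /F1 Re_mulc /= mul0r subr0.
- have := h _ cFi; congr measurable_fun; apply/funext => p.
  by rewrite /F1 Im_mulc /= mul0r addr0.
- exists M => p _; rewrite /F1 indicE; case: (boolP (p \in D2)) => [|_]; last first.
    by rewrite mul0r normc0 ltW.
  by rewrite inE => Dp; rewrite mul1r; exact: FM.
Qed.

Lemma bmeas_pt : bmeas Q (@pt R).
Proof.
split.
- by apply: measurable_fst.
- by apply: measurable_snd.
- exists (normc c + 4 * r) => p [].
  rewrite /= !in_itv /= => /andP[h1 h2] /andP[h3 h4].
  change (normc (pt p) <= normc c + 4 * r).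
  have -> : pt p = c + (pt p - c) by ring.
  rewrite (le_trans (le_normcD _ _))// lerD2l (le_trans (normc_le_ReIm _))//.
  case: (c) h1 h2 h3 h4 => c1 c2 /= h1 h2 h3 h4.
  have -> : 4 * r = 2 * r + 2 * r by ring.
  by apply: lerD; apply/ler_normlP; split; lra.
Qed.

(** The set of poles [p] for which [h = (z - p) (F z - F p)] is small, where a
polynomial in [h] cannot invert [h]. *)
Definition near_level (z : R[i]) (d : R) : set (plane R) :=
  [set p | D2 p /\ normc (z - pt p) * normc (F z - F (pt p)) <= d].

Lemma near_level_measurable z d : measurable (near_level z d).
Proof.
have m1 : measurable_fun D2 (fun p => normc (z - pt p)).
  by apply: measurable_funTS; exact: continuous_plane_measurable (@normc_pt_continuous _ z).
have m2 : measurable_fun D2 (fun p => normc (F z - F (pt p))).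
  apply: measurable_normc.
  - under eq_fun do rewrite raddfB; apply: measurable_funB; first exact: measurable_cst.
    exact: within_continuous_measurable plane_disc_measurable cFr.
  - under eq_fun do rewrite raddfB; apply: measurable_funB; first exact: measurable_cst.
    exact: within_continuous_measurable plane_disc_measurable cFi.
have := measurable_funM m1 m2.
move=> /(_ plane_disc_measurable [set` `]-oo, d]] (measurable_itv _)).
by congr measurable; apply/seteqP; split => p /=; rewrite in_itv /=.
Qed.

(** For poles in [G] the Cauchy kernel is approximated with an error relative to
its own size, small off [near_level].  The bound [B] on the error there is chosen
before [d] and [t], so that [near_level z d] can afterwards be made small enough
to compensate it. *)
Definition approximable (G : set (plane R)) : Prop := exists2 B : R, 0 <= B &
  forall d t : R, 0 < d -> 0 < t -> exists2 a, separable Q A a &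
    forall p z, G p -> D z ->
      normc (a p z - (z - pt p)^-1) <=
        (t + B * \1_(near_level z d) p) * (normc (z - pt p))^-1.

Lemma approximableU G1 G2 : measurable G1 -> approximable G1 -> approximable G2 ->
  approximable (G1 `|` G2).
Proof.
move=> m1 [B1 B10 g1] [B2 B20 g2]; exists (B1 + B2); first exact: addr_ge0.
move=> d t d0 t0; have [a1 s1 h1] := g1 d t d0 t0; have [a2 s2 h2] := g2 d t d0 t0.
(* cutting the second kernel off on [G1] makes the two pieces disjoint *)
exists (fun p z => (\1_G1 p)%:C * a1 p z + (\1_(~` G1) p)%:C * a2 p z).
  by apply: separable_add; apply: separable_mul => //; apply: separable_fst => //;
    apply: bmeas_indic => //; exact: measurableC.
move=> p z Gp Dz.
have i0 : 0 <= \1_(near_level z d) p :> R by rewrite indicE.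
have w0 : 0 <= (normc (z - pt p))^-1 by rewrite invr_ge0 normc_ge0.
have [G1p|G1p] := pselect (G1 p).
  rewrite !indicE mem_set// memNset /=; last by [].
  rewrite mul1r mul0r addr0 (le_trans (h1 p z G1p Dz))// ler_wpM2r// lerD2l.
  by rewrite ler_wpM2r// lerDl.
have G2p : G2 p by case: Gp.
rewrite !indicE memNset// mem_set//= mul1r mul0r add0r.
by rewrite (le_trans (h2 p z G2p Dz))// ler_wpM2r// lerD2l ler_wpM2r// lerDr.
Qed.

Lemma approximable0 : approximable set0.
Proof.
exists 0 => // d t _ _; exists (fun _ _ => 0) => //.
exact: separable_fst AA _ (bmeas_cst Q 0).
Qed.

Definition outside (n : nat) : set (plane R) := Q `&` [set p | r + n.+1%:R^-1 <= normc (pt p - c)].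

Lemma outside_measurable n : measurable (outside n).
Proof.
apply: measurableI => //.
have := continuous_plane_measurable (@normc_pt_continuous R c).
move=> /(_ measurableT [set` `[r + n.+1%:R^-1, +oo[] (measurable_itv _)); rewrite setTI.
by congr measurable; apply/seteqP; split => p /=; rewrite in_itv /= andbT normcB.
Qed.

Lemma bmeas_inv_outside n : bmeas Q (fun p => (\1_(outside n) p)%:C * (pt p - c)^-1).
Proof.
have m1 : measurable_fun setT (fun p : plane R => complex.Re (pt p - c)).
  under eq_fun do rewrite raddfB; apply: measurable_funB => //.
  exact: measurable_fst.
have m2 : measurable_fun setT (fun p : plane R => complex.Im (pt p - c)).
  under eq_fun do rewrite raddfB; apply: measurable_funB => //.
  exact: measurable_snd.
have mn : measurable_fun setT (fun p : plane R => (normc (pt p - c) ^+ 2)^-1).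
  apply: measurableT_comp; first exact: measurable_inv.
  by apply: measurable_funX; exact: measurable_normc.
have mi : measurable_fun setT (\1_(outside n) : plane R -> R).
  exact: measurable_indic (outside_measurable n).
split.
- under eq_fun do rewrite Re_mulc Re_invc /= mul0r subr0.
  by apply: measurable_funM => //; exact: measurable_funM.
- under eq_fun do rewrite Im_mulc Im_invc /= mul0r addr0.
  by apply: measurable_funM => //; apply: measurable_funM => //; exact: measurable_funN.
- exists r^-1 => p _; rewrite indicE; case: (boolP (p \in outside n)) => [|_].
    rewrite inE => -[_ /= h]; rewrite mul1r normcV lef_pV2 ?posrE//.
      by rewrite (le_trans _ h)// lerDl.
    by rewrite (lt_le_trans _ h)// ltr_pwDl.
  by rewrite mul0r normc0 invr_ge0 ltW.
Qed.

(** On the disc [|z - c| <= r], while [|p - c|] exceeds [r] by a fixed amount, so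
[1 / (z - p)] is the sum of a geometric series in [(z - c) / (p - c)], which
converges uniformly. *)
Lemma approximable_outside n : approximable (outside n).
Proof.
exists 0 => // d t d0 t0.
have n0 : 0 < n.+1%:R^-1 :> R by rewrite invr_gt0.
pose q := r / (r + n.+1%:R^-1).
have rn0 : 0 < r + n.+1%:R^-1 by rewrite addr_gt0.
have q01 : 0 <= q < 1.
  by rewrite divr_ge0 ?(ltW r0) ?(ltW rn0)//= ltr_pdivrMr// mul1r ltrDl.
have [m qm] := expr_small q01 t0.
pose u p := (\1_(outside n) p)%:C * (pt p - c)^-1.
pose s : {poly R[i]} := \sum_(k < m) 'X^k.
have [Ac AD AM] := AA.
exists (fun p z => - u p * s.[(z - c) * u p]).
  have su := separable_fst AA (bmeas_inv_outside n).
  apply: separable_mul => //.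
    have := separable_mul AA (separable_fst AA (bmeas_cst Q (-1))) su.
    by congr separable; apply/funext => p; apply/funext => z; rewrite mulN1r.
  apply: separable_poly => //; apply: separable_mul => //; apply: separable_snd => //.
  exact: AD Aid (Ac (- c)).
move=> p z Gp Dz; rewrite mul0r addr0 /u indicE mem_set// mul1r.
have [_ /= hp] := Gp.
have pc0 : 0 < normc (pt p - c) by exact: lt_le_trans hp.
have pc0' : pt p - c != 0 by rewrite -normc_gt0.
set T := (z - c) * (pt p - c)^-1.
have Tq : normc T <= q.
  rewrite /T normcM normcV /q ler_pM ?invr_ge0 ?normc_ge0//.
  by rewrite lef_pV2 ?posrE.
have w0 : z - pt p != 0.
  apply: contraTneq hp => zp; rewrite -ltNge -(subr0 (pt p)).
  have -> : pt p - 0 - c = z - c - (z - pt p) by ring.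
  by rewrite zp subr0 (le_lt_trans Dz)// ltrDl.
have wE : (z - pt p)^-1 = (pt p - c)^-1 / (T - 1).
  rewrite -invfM; congr (_^-1).
  by rewrite /T mulrBr mulr1 mulrCA divff// mulr1; ring.
have T1 : T - 1 != 0.
  apply: contraNneq w0 => T1; have : (z - pt p)^-1 = 0 by rewrite wE T1 invr0 mulr0.
  by move/eqP; rewrite invr_eq0.
have sE : s.[T] = (T ^+ m - 1) / (T - 1).
  rewrite /s horner_sum; under eq_bigr do rewrite hornerXn.
  by rewrite subrX1 mulrAC divff// mul1r.
rewrite sE wE.
have -> : - (pt p - c)^-1 * ((T ^+ m - 1) / (T - 1)) - (pt p - c)^-1 / (T - 1)
   = - (T ^+ m * ((pt p - c)^-1 / (T - 1))) by ring.
rewrite normcN normcM -wE normcV ler_wpM2r ?invr_ge0 ?normc_ge0//.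
rewrite normcX (le_trans _ (ltW qm))// lerXn2r// nnegrE ?normc_ge0//.
by case/andP: q01.
Qed.

Definition sector_points (k : R) (e : R[i]) : set (plane R) :=
  [set p | D2 p /\ forall z, D z -> avoids_ray k e ((z - pt p) * (F z - F (pt p)))].

(** Multiplying [1 - h p(h)] by [1 / (z - p)] turns the estimates of
[sector_poly] into a comparison of [1 / (z - p)] with [(F z - F p) p(h)]. *)
Lemma approximable_sector k e : 0 < k -> k <= 1 -> normc e = 1 ->
  approximable (sector_points k e).
Proof.
move=> k0 k1 e1; exists (k^-1 + 1); first by rewrite addr_ge0// invr_ge0 ltW.
move=> d t d0 t0; have [M M0 FM] := disc_bounded.
have [s hs] := @sector_poly R ((2 * r) * (2 * M)) k e k0 k1 e1 d t d0 t0.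
have [Ac AD AM] := AA.
have s1 : separable Q A (fun p z => z - pt p).
  have := separable_add (separable_snd Q Aid)
    (separable_fst AA (bmeasM (bmeas_cst Q (-1)) bmeas_pt)).
  by congr separable; apply/funext => p; apply/funext => z; rewrite mulN1r.
have s2 : separable Q A (fun p z => F z - F1 p).
  have := separable_add (separable_snd Q AF)
    (separable_fst AA (bmeasM (bmeas_cst Q (-1)) bmeas_F1)).
  by congr separable; apply/funext => p; apply/funext => z; rewrite mulN1r.
exists (fun p z => (F z - F1 p) * s.[(z - pt p) * (F z - F1 p)]).
  apply: separable_mul => //; apply: separable_poly => //; exact: separable_mul.
move=> p z [Dp Gp] Dz.
have -> : F1 p = F (pt p) by rewrite /F1 indicE mem_set// mul1r.
set h := (z - pt p) * _.
have [w0|w0] := eqVneq (z - pt p) 0.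
  have -> : F z = F (pt p) by congr F; apply/eqP; rewrite -subr_eq0 w0.
  by rewrite w0 subrr mul0r invr0 subrr normc0 invr0 mulr0.
have -> : (F z - F (pt p)) * s.[h] - (z - pt p)^-1 = - ((1 - h * s.[h]) / (z - pt p)).
  by rewrite /h; field; rewrite w0.
rewrite normcN normcM normcV ler_wpM2r ?invr_ge0 ?normc_ge0//.
have hM : normc h <= 2 * r * (2 * M).
  rewrite normcM ler_pM ?normc_ge0//.
    have -> : z - pt p = (z - c) - (pt p - c) by ring.
    rewrite (le_trans (le_normcB _ _))//.
    by have : normc (z - c) <= r := Dz; have : normc (pt p - c) <= r := Dp; lra.
  rewrite (le_trans (le_normcB _ _))//.
  by have := FM _ Dz; have := FM _ Dp; lra.
have [h1 h2] := hs h hM (Gp z Dz).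
have [hd|hd] := lerP d (normc h).
  by rewrite (le_trans (h2 hd))// lerDl mulr_ge0// addr_ge0// invr_ge0 ltW.
rewrite indicE mem_set; last by split => //; rewrite -normcM ltW.
by rewrite mulr1 (le_trans h1)// lerDr ltW.
Qed.

(** The set is closed: it is an intersection, over [z] and [l], of closed
conditions on [p]. *)
Lemma sector_points_measurable k e : measurable (sector_points k e).
Proof.
apply: closed_plane_measurable.
pose H (zl : R[i] * R) (p : plane R) :=
  normc ((zl.1 - pt p) * (F zl.1 - F (pt p)) + zl.2%:C * e).
have -> : sector_points k e = \bigcap_(zl in [set zl : R[i] * R | D zl.1 /\ 0 <= zl.2])
    (D2 `&` H zl @^-1` [set x | k * zl.2 <= x]) `&` D2.
  apply/seteqP; split => [p [Dp Gp]|p [Gp Dp]].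
    by split => // -[z l] [Dz l0]; split => //=; exact: Gp.
  by split => // z Dz l l0; have [_] := Gp (z, l) (conj Dz l0).
apply: closedI; last exact: plane_disc_closed.
apply: closed_bigI => -[z l] _.
have cH : {within D2, continuous (H (z, l))}.
  pose T := subspace D2.
  have c1 : continuous ((fun p : plane R => p.1 : R) : T -> R).
    by apply: continuous_subspaceT => p; exact: cvg_fst.
  have c2 : continuous ((fun p : plane R => p.2 : R) : T -> R).
    by apply: continuous_subspaceT => p; exact: cvg_snd.
  pose w1 (p : T) : R := complex.Re z - p.1; pose w2 (p : T) : R := complex.Im z - p.2.
  pose f1 (p : T) : R := complex.Re (F z) - complex.Re (F (pt p)).
  pose f2 (p : T) : R := complex.Im (F z) - complex.Im (F (pt p)).
  have cw1 : continuous w1 by exact: contD (@contC _ _ _) (contN c1).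
  have cw2 : continuous w2 by exact: contD (@contC _ _ _) (contN c2).
  have cf1 : continuous f1 by exact: contD (@contC _ _ _) (contN cFr).
  have cf2 : continuous f2 by exact: contD (@contC _ _ _) (contN cFi).
  have -> : H (z, l) = (fun p : T => normc
      ((w1 p * f1 p + - (w2 p * f2 p) + l * complex.Re e) +i*
       (w1 p * f2 p + w2 p * f1 p + l * complex.Im e))).
    apply/funext => p; apply: (f_equal (@normc R)).
    apply/eqP; rewrite eq_complex /= !raddfD /= !Re_mulc !Im_mulc /=.
    rewrite /w1 /w2 /f1 /f2 !raddfB /= mul0r subr0 mul0r addr0.
    by case: (z) => ? ? /=; rewrite !eqxx.
  apply: normc_continuous.
    exact: contD (contD (contM cw1 cf1) (contN (contM cw2 cf2))) (@contC _ _ _).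
  exact: contD (contD (contM cw1 cf2) (contM cw2 cf1)) (@contC _ _ _).
have /closed_subspaceP[V cV VD] := closed_comp (fun p _ => cH p) (@closed_ge _ (k * l)).
rewrite setIC; move: VD; rewrite /= => <-.
by apply: closedI => //; exact: plane_disc_closed.
Qed.

(** For a single [z] the sets decrease to a level set of [F].  Moving [z] to a
nearby point changes [h] by little, uniformly in [p], so that a threshold good
for [z] is, after halving, good near [z]; compactness concludes. *)
Lemma near_level_uniform (a : R) :
  (forall z, D z -> exists N, [/\ measurable N, area R N = 0%E &
     [set p | D2 p /\ F (pt p) = F z] `<=` N]) ->
  0 < a -> exists2 d : R, 0 < d & forall z, D z -> (area R (near_level z d) <= a%:E)%E.
Proof.
move=> lev a0; have [M M0 FM] := disc_bounded.
have mono z d d' : d <= d' -> near_level z d `<=` near_level z d'.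
  by move=> dd p [Dp h]; split => //; exact: le_trans h dd.
have sQ z d : near_level z d `<=` Q by move=> p [/plane_disc_square].
have small z : D z -> exists2 d : R, 0 < d & (area R (near_level z (2 * d)) <= a%:E)%E.
  move=> Dz; have [N [mN N0 levN]] := lev z Dz.
  have dec n m : (n <= m)%N ->
      near_level z (2 * m.+1%:R^-1) `<=` near_level z (2 * n.+1%:R^-1).
    by move=> nm; apply: mono; rewrite ler_pM2l// lef_pV2 ?posrE// ler_nat ltnS.
  have cap : \bigcap_n near_level z (2 * n.+1%:R^-1) `<=` N.
    move=> p hp; apply: levN; have [Dp _] := hp 0%N I; split => //.
    apply/eqP; rewrite eq_sym -subr_eq0; apply: contraT => n0.
    have w0 : z - pt p != 0.
      by apply: contraNneq n0 => zp; rewrite -(subrK (pt p) z) zp add0r subrr.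
    have h0 : 0 < normc (z - pt p) * normc (F z - F (pt p)) by rewrite mulr_gt0 ?normc_gt0.
    have := @near_infty_natSinv_lt R (PosNum (divr_gt0 h0 (ltr0Sn _ 1))).
    case=> n _ /(_ n (leqnn n)) /=; have [_] := hp n I.
    by set u := n.+1%:R^-1; lra.
  have [n hn] := shrinking_area a0 (fun n => near_level_measurable z _)
    (sub_fin (near_level_measurable z _) (@sQ z _)) dec mN N0 cap.
  by exists n.+1%:R^-1 => //; rewrite invr_gt0.
have nearF (x : plane R) (t : R) : D2 x -> 0 < t -> \forall x' \near x, D2 x' ->
    normc (pt x - pt x') <= t /\ normc (F (pt x) - F (pt x')) <= 2 * t.
  move=> Dx t0.
  have := (subspace_continuousP _ _).1 cFr x Dx.
  move=> /cvgrPdist_lt/(_ t t0); rewrite near_withinE => n1.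
  have := (subspace_continuousP _ _).1 cFi x Dx.
  move=> /cvgrPdist_lt/(_ t t0); rewrite near_withinE => n2.
  have n3 := near_pt x t0.
  near=> x' => Dx'; split; first by apply: ltW; near: x'.
  rewrite (le_trans (normc_le_ReIm _))// mulr2n mulrDl !mul1r !raddfB /=.
  by apply: lerD; apply: ltW; move: Dx'; near: x'.
have : \forall d \near 0^'+, D2 `<=` (fun p => (area R (near_level (pt p) d) <= a%:E)%E).
  apply: (near_covering_withinP D2).2; first exact/compact_near_coveringP/plane_disc_compact.
  move=> x Dx; have [d d0 hd] := small (pt x) Dx.
  have Mr : 0 < 2 * M + 4 * r by move: r0; lra.
  have t0 : 0 < d / (2 * M + 4 * r) by rewrite divr_gt0.
  have nx := nearF x _ Dx t0.
  near=> x' d'.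
  have d'd : d' <= d by near: d'; exact: nbhs_right_le.
  have hx' : D2 x' -> normc (pt x - pt x') <= d / (2 * M + 4 * r) /\
      normc (F (pt x) - F (pt x')) <= 2 * (d / (2 * M + 4 * r)).
    by near: x'.
  move=> /= Dx'; have [h1 h2] := hx' Dx'.
  apply: le_trans hd; apply: le_measure; rewrite ?inE; try exact: near_level_measurable.
  move=> p [Dp hp]; split => //.
  have -> : pt x - pt p = (pt x - pt x') + (pt x' - pt p) by ring.
  have h3 : normc (F (pt x) - F (pt p)) <= 2 * M.
    by rewrite (le_trans (le_normcB _ _))//; have := FM _ Dx; have := FM _ Dp; lra.
  have h4 : normc (pt x' - pt p) <= 2 * r.
    have -> : pt x' - pt p = (pt x' - c) - (pt p - c) by ring.
    rewrite (le_trans (le_normcB _ _))//.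
    by have : normc (pt x' - c) <= r := Dx'; have : normc (pt p - c) <= r := Dp; lra.
  have h5 : normc (F (pt x) - F (pt p)) <=
      normc (F (pt x) - F (pt x')) + normc (F (pt x') - F (pt p)).
    have -> : F (pt x) - F (pt p) = (F (pt x) - F (pt x')) + (F (pt x') - F (pt p)) by ring.
    exact: le_normcD.
  set X := normc (pt x - pt x') in h1 *; set Y := normc (pt x' - pt p) in h4 hp *.
  set U := normc (F (pt x) - F (pt p)) in h3 h5 *.
  set V := normc (F (pt x) - F (pt x')) in h2 h5.
  set W := normc (F (pt x') - F (pt p)) in hp h5.
  apply: (@le_trans _ _ ((X + Y) * U)); first by rewrite ler_wpM2r ?normc_ge0// le_normcD.
  have XU : X * U <= d / (2 * M + 4 * r) * (2 * M) by rewrite ler_pM ?normc_ge0.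
  have YU : Y * U <= Y * V + Y * W by rewrite -mulrDr ler_wpM2l ?normc_ge0.
  have YV : Y * V <= 2 * r * (2 * (d / (2 * M + 4 * r))) by rewrite ler_pM ?normc_ge0.
  have E : d / (2 * M + 4 * r) * (2 * M + 4 * r) = d by rewrite divfK// gt_eqF.
  by lra.
move=> [t /= t0 Ht]; have t20 : 0 < t / 2 by rewrite divr_gt0.
exists (t / 2) => // z Dz.
have Hz := Ht (t / 2) _ t20 (complex.Re z, complex.Im z).
rewrite pt_ReIm in Hz; apply: Hz; first by rewrite /= sub0r normrN gtr0_norm//; lra.
by rewrite /D2 /plane_disc /mkset pt_ReIm.
Unshelve. all: by end_near. Qed.

(** * The error made by regularising the Cauchy kernel *)
Lemma bmeas_reg_cauchy (e : R) z : 0 < e -> bmeas Q (fun p => reg_cauchy e (z - pt p)).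
Proof.
move=> e0.
have m1 : measurable_fun setT (fun p : plane R => complex.Re (z - pt p)).
  by under eq_fun do rewrite raddfB; apply: measurable_funB => //; exact: measurable_fst.
have m2 : measurable_fun setT (fun p : plane R => complex.Im (z - pt p)).
  by under eq_fun do rewrite raddfB; apply: measurable_funB => //; exact: measurable_snd.
have mf : measurable_fun setT (fun p : plane R => (normc (z - pt p) ^+ 2 + e)^-1).
  apply: measurableT_comp; first exact: measurable_inv.
  apply: measurable_funD => //; apply: measurable_funX; exact: measurable_normc.
have reE (w : R[i]) : complex.Re (reg_cauchy e w) = complex.Re w * (normc w ^+ 2 + e)^-1.
  by rewrite /reg_cauchy Re_mulc; case: w => x y; rewrite [LHS]/= mulr0 subr0.
have imE (w : R[i]) : complex.Im (reg_cauchy e w) = - (complex.Im w * (normc w ^+ 2 + e)^-1).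
  by rewrite /reg_cauchy Im_mulc; case: w => x y; rewrite [LHS]/= mulr0 add0r mulNr.
split.
- by under eq_fun do rewrite reE; exact: measurable_funM.
- by under eq_fun do rewrite imE; apply: measurable_funN; exact: measurable_funM.
exists (e^-1 + 1) => p _; set w := z - pt p.
have n0 : 0 < normc w ^+ 2 + e by rewrite ltr_wpDl ?sqr_ge0.
rewrite /reg_cauchy normcM normcR ger0_norm ?invr_ge0 ?(ltW n0)//.
have -> : normc (conjc w) = normc w by case: (w) => x y; rewrite /normc /= sqrrN.
rewrite ler_pdivrMr//.
have -> : (e^-1 + 1) * (normc w ^+ 2 + e) = e^-1 * normc w ^+ 2 + 1 + (normc w ^+ 2 + e).
  by field; rewrite gt_eqF.
have h1 : 0 <= e^-1 * normc w ^+ 2 by rewrite mulr_ge0 ?sqr_ge0// invr_ge0 ltW.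
have h2 : 0 <= (normc w - 1) ^+ 2 by rewrite sqr_ge0.
by have h3 := normc_ge0 w; lra.
Qed.

Definition near_disc (z : R[i]) (rho : R) : set (plane R) :=
  Q `&` [set p | normc (z - pt p) <= rho].

Lemma near_disc_measurable z rho : measurable (near_disc z rho).
Proof.
apply: measurableI => //.
have := continuous_plane_measurable (@normc_pt_continuous R z).
move=> /(_ measurableT [set` `]-oo, rho]] (measurable_itv _)); rewrite setTI.
by congr measurable; apply/seteqP; split => p /=; rewrite in_itv.
Qed.

Lemma near_disc_area z rho : 0 <= rho -> (area R (near_disc z rho) <= ((2 * rho) ^+ 2)%:E)%E.
Proof.
move=> rho0; rewrite -(area_square (complex.Re z) (complex.Im z) rho0).
apply: le_measure; rewrite ?inE; [exact: near_disc_measurable|exact: measurable_square|].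
by move=> p [_]; exact: square_normc.
Qed.

(** The left-hand side bounds the error in [reg_cauchy_err].  Within distance
[rho] of [z] its first factor is at most 1, further away it is at most
[e / rho^2]. *)
Lemma reg_error_bound (e rho : R) (z : R[i]) p : 0 < e -> 0 < rho -> Q p ->
  (e / (normc (z - pt p) ^+ 2 + e)) * (normc (z - pt p))^-1 <=
  weight (near_disc z rho) z p + e / rho ^+ 2 * weight Q z p.
Proof.
move=> e0 rho0 Qp; have n0 : 0 < normc (z - pt p) ^+ 2 + e by rewrite ltr_wpDl ?sqr_ge0.
rewrite /weight mulrA -mulrDl ler_wpM2r ?invr_ge0 ?normc_ge0//.
have -> : \1_Q p = 1 :> R by rewrite indicE mem_set.
rewrite mulr1 indicE.
have er : 0 < rho ^+ 2 by rewrite exprn_gt0.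
case: (boolP (p \in _)) => [_|].
  rewrite -[leLHS]addr0 lerD ?divr_ge0 ?(ltW er) ?(ltW e0)//.
  by rewrite ler_pdivrMr// mul1r lerDr sqr_ge0.
rewrite notin_setE => h; rewrite add0r ler_wpM2l ?(ltW e0)// lef_pV2 ?posrE//.
have : rho <= normc (z - pt p) by rewrite leNgt; apply/negP => h'; apply: h; split=> //=; exact: ltW.
move=> h1; rewrite -[leLHS]addr0 lerD ?(ltW e0)// lerXn2r// nnegrE ?normc_ge0// ltW//.
Qed.

Lemma reg_error_small (t : R) : 0 < t -> exists2 e0 : R, 0 < e0 & forall e z, 0 < e -> e <= e0 ->
  exists k : plane R -> R, [/\ measurable_fun setT k, (forall p, 0 <= k p),
    forall p, Q p -> (e / (normc (z - pt p) ^+ 2 + e)) * (normc (z - pt p))^-1 <= k p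
    & (\int[area R]_(p in Q) (k p)%:E <= t%:E)%E].
Proof.
move=> t0; have t20 : 0 < t / 2 by rewrite divr_gt0.
have [a a0 ha] := weight_small mQ t20.
have [J J0 hJ] := weight_bounded mQ fQ.
pose rho := Num.min 1 (a / 4).
have rho0 : 0 < rho by rewrite lt_min ltr01 divr_gt0.
have rhoa : (2 * rho) ^+ 2 <= a.
  have h1 : rho <= 1 by rewrite ge_min lexx.
  have h2 : rho <= a / 4 by rewrite ge_min lexx orbT.
  have : rho * rho <= 1 * (a / 4) by rewrite ler_pM// ltW.
  by rewrite expr2; lra.
exists (t / 2 / J * rho ^+ 2); first by rewrite !mulr_gt0 ?invr_gt0// exprn_gt0.
move=> e z e0 ee.
exists (fun p => weight (near_disc z rho) z p + e / rho ^+ 2 * weight Q z p).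
have er : 0 <= e / rho ^+ 2 by rewrite divr_ge0 ?exprn_ge0// ltW.
have m1 := measurable_weight z (near_disc_measurable z rho).
have m2 := measurable_weight z mQ.
split.
- by apply: measurable_funD => //; exact: measurable_funM.
- by move=> p; apply: addr_ge0; [exact: weight_ge0|apply: mulr_ge0 => //; exact: weight_ge0].
- by move=> p; exact: reg_error_bound.
have -> : t = t / 2 + t / 2 by lra.
apply: (integral_leD mQ) => //.
- exact: measurable_funM.
- by move=> p; exact: weight_ge0.
- by move=> p; rewrite mulr_ge0 ?weight_ge0.
- apply: ha; first exact: near_disc_measurable.
  by apply: le_trans (near_disc_area z (ltW rho0)) _; rewrite lee_fin.
apply: le_trans (integral_leZ mQ er m2 (fun p => weight_ge0 Q z p) (hJ z)) _.
rewrite lee_fin -ler_pdivlMr// ler_pdivrMr ?exprn_gt0//.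
Qed.

(** * Cauchy transforms in the closure *)
Section Cover.
Variables (N : set (plane R)) (es : nat -> R[i]) (ks : nat -> R).
Hypotheses (mN : measurable N) (N0 : area R N = 0%E)
  (esks : forall n, [/\ 0 < ks n, ks n <= 1 & normc (es n) = 1])
  (cover : forall p, D2 p -> ~ N p -> exists n, sector_points (ks n) (es n) p).

Let G n := \big[setU/set0]_(i < n) (sector_points (ks i) (es i) `|` outside i).

(** The sets of poles treated by [approximable_sector] and
[approximable_outside] cover the square up to a null set, hence finitely many of
them cover it up to small area. *)
Lemma approximable_exhaustion (a : R) : 0 < a -> exists H : set (plane R),
  [/\ measurable H, approximable H & (area R (Q `\` H) <= a%:E)%E].
Proof.
move=> a0.
have mG1 i : measurable (sector_points (ks i) (es i) `|` outside i).
  by apply: measurableU; [exact: sector_points_measurable|exact: outside_measurable].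
have mG n : measurable (G n) by exact: bigsetU_measurable.
have gG n : approximable (G n).
  rewrite /G; elim: n => [|n IH]; first by rewrite big_ord0; exact: approximable0.
  rewrite big_ord_recr; apply: approximableU => //; first exact: bigsetU_measurable.
  have [k0 k1 e1] := esks n.
  apply: approximableU; [exact: sector_points_measurable| |exact: approximable_outside].
  exact: approximable_sector.
have dec n m : (n <= m)%N -> Q `\` G m `<=` Q `\` G n.
  move=> nm p [Qp Gp]; split => //; apply: contra_not Gp; rewrite /G.
  pose f i := sector_points (ks i) (es i) `|` outside i.
  rewrite -(bigcup_mkord n f) -(bigcup_mkord m f).
  by move=> [i /= im h]; exists i => //=; exact: leq_trans im nm.
have cap : \bigcap_n (Q `\` G n) `<=` N.
  move=> p hp; have Qp : Q p by have [] := hp 0%N I.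
  apply: contrapT => Np.
  have inG n : (sector_points (ks n) (es n) `|` outside n) p -> False.
    move=> h; have [_] := hp n.+1 I; apply.
    by rewrite /G big_ord_recr; right.
  have [Dp|Dp] := pselect (D2 p).
    by have [n hn] := cover Dp Np; apply: (inG n); left.
  have rp : 0 < normc (pt p - c) - r.
    by rewrite subr_gt0 ltNge; apply/negP.
  have := @near_infty_natSinv_lt R (PosNum rp).
  case=> n _ /(_ n (leqnn n)) /= hn; apply: (inG n); right; split => //=.
  by move: hn; set u := n.+1%:R^-1; lra.
have [n hn] := shrinking_area a0 (fun n => measurableD mQ (mG n))
  (sub_fin (measurableD mQ (mG 0%N)) (@subDsetl _ Q (G 0%N))) dec mN N0 cap.
by exists (G n); split.
Qed.

Hypothesis lev : forall z, D z -> exists N, [/\ measurable N, area R N = 0%E &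
     [set p | D2 p /\ F (pt p) = F z] `<=` N].

(** The difference of the kernels has four parts, each with integral at most [s]:
the regularisation, the relative error [s / J], the error on [near_level], and
the poles outside [H], where the kernel is replaced by 0.  The order of choices
is [H], then its bound [B], then [d], then the approximating kernel. *)
Lemma cauchy_transform_approx (u : plane R -> R[i]) (t : R) : bmeas Q u -> 0 < t ->
  exists2 e0 : R, 0 < e0 & forall e, 0 < e -> e <= e0 ->
  exists2 g, A g & forall z, D z ->
    normc (Cint Q (fun p => u p * reg_cauchy e (z - pt p)) - g z) <= t.
Proof.
move=> bu t0; have [_ _ [V0 hV0]] := bu.
pose V := 1 + `|V0|; have V1 : 0 < V by rewrite ltr_pwDl.
have hV p : Q p -> normc (u p) <= V.
  by move=> Qp; rewrite (le_trans (hV0 p Qp))// (le_trans (ler_norm _))// lerDr.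
pose s := t / (8 * V); have s0 : 0 < s by rewrite divr_gt0 ?mulr_gt0.
have [J J0 hJ] := weight_bounded mQ fQ.
have [a a0 ha] := weight_small mQ s0.
have [H [mH gH Ha]] := approximable_exhaustion a0.
have [B B0 hB] := gH.
have B1 : 0 < B + 1 by rewrite ltr_wpDl.
have [a' a'0 ha'] := weight_small mQ (divr_gt0 s0 B1).
have [d d0 hd] := near_level_uniform lev a'0.
have [k sk hk] := hB d (s / J) d0 (divr_gt0 s0 J0).
have [e0 e00 he] := reg_error_small s0.
exists e0 => // e epos ee.
have sk' : separable Q A (fun p z => u p * ((\1_H p)%:C * k p z)).
  apply: separable_mul => //; first exact: separable_fst.
  apply: separable_mul => //; apply: separable_fst => //; exact: bmeas_indic.
exists (fun z => Cint Q (fun p => u p * ((\1_H p)%:C * k p z))).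
  exact: separable_Cint sk'.
move=> z Dz.
have [K [mK K0 hK iK]] := he e z epos ee.
have breg : bmeas Q (fun p => reg_cauchy e (z - pt p)).
  exact: bmeas_reg_cauchy.
have bk := separable_bmeas z sk'.
have -> : Cint Q (fun p => u p * reg_cauchy e (z - pt p)) -
    Cint Q (fun p => u p * ((\1_H p)%:C * k p z)) =
  Cint Q (fun p => u p * reg_cauchy e (z - pt p) + (-1) * (u p * ((\1_H p)%:C * k p z))).
  rewrite CintD//; [|exact: bmeasM|exact: bmeasM (bmeas_cst Q (-1)) bk].
  by rewrite CintZ// mulN1r.
pose W p := V * (K p + (s / J * weight Q z p + (B * weight (near_level z d) z p + weight (Q `\` H) z p))).
have mQH : measurable (Q `\` H) by exact: measurableD.
have mnl := near_level_measurable z d.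
have mw1 := measurable_weight z mQ.
have mw2 := measurable_weight z mnl.
have mw3 := measurable_weight z mQH.
have mC (k0 : R) f : measurable_fun setT f -> measurable_fun setT (fun p : plane R => k0 * f p).
  by move=> mf; exact: measurable_funM.
have mW3 := measurable_funD (mC B _ mw2) mw3.
have mW2 := measurable_funD (mC (s / J) _ mw1) mW3.
have mW1 := measurable_funD mK mW2.
have -> : t = 2 * (V * (4 * s)).
  by rewrite /s; field; rewrite gt_eqF.
have sJ : 0 <= s / J by rewrite divr_ge0// ltW.
have W3 p : 0 <= B * weight (near_level z d) z p + weight (Q `\` H) z p.
  by apply: addr_ge0; [apply: mulr_ge0 => //; exact: weight_ge0|exact: weight_ge0].
have W2 p : 0 <= s / J * weight Q z p + (B * weight (near_level z d) z p + weight (Q `\` H) z p).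
  by rewrite addr_ge0// mulr_ge0 ?weight_ge0.
apply: (@Cint_le R Q mQ fQ _ W).
- apply: bmeasD; first exact: bmeasM.
  exact: bmeasM (bmeas_cst Q (-1)) bk.
- exact: mC.
- move=> p Qp.
  have -> : u p * reg_cauchy e (z - pt p) + -1 * (u p * ((\1_H p)%:C * k p z)) =
     u p * ((reg_cauchy e (z - pt p) - (z - pt p)^-1) +
       ((z - pt p)^-1 - (\1_H p)%:C * k p z)) by ring.
  rewrite normcM /W ler_pM ?normc_ge0//; first exact: hV.
  rewrite (le_trans (le_normcD _ _))// lerD//.
    by rewrite (le_trans (reg_cauchy_err _ epos))// hK.
  have wz : 0 <= (normc (z - pt p))^-1 by rewrite invr_ge0 normc_ge0.
  have [Hp|Hp] := pselect (H p).
    rewrite indicE mem_set// mul1r normcB (le_trans (hk p z Hp Dz))//.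
    rewrite addrA -[leLHS]addr0 lerD ?weight_ge0//.
    rewrite /weight; have -> : \1_Q p = 1 :> R by rewrite indicE mem_set.
    by rewrite mul1r mulrDl mulrA.
  rewrite indicE memNset//= mul0r subr0 normcV.
  rewrite addrA -[leLHS]add0r; apply: lerD.
    by apply: addr_ge0; apply: mulr_ge0 => //; exact: weight_ge0.
  by rewrite /weight indicE mem_set ?mul1r.
apply: (integral_leZ mQ) => //; first exact: ltW.
  by move=> p; exact: addr_ge0.
have -> : 4 * s = s + (s + (s + s)) by ring.
apply: (integral_leD mQ) => //.
apply: (integral_leD mQ) => //.
- exact: mC.
- by move=> p; rewrite mulr_ge0 ?weight_ge0.
- apply: le_trans (integral_leZ mQ sJ mw1 (fun p => weight_ge0 Q z p) (hJ z)) _.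
  by rewrite divfK// gt_eqF.
apply: (integral_leD mQ) => //.
- exact: mC.
- by move=> p; rewrite mulr_ge0 ?weight_ge0.
- by move=> p; exact: weight_ge0.
- apply: le_trans (integral_leZ mQ B0 mw2 (fun p => weight_ge0 _ z p) (ha' _ z mnl (hd z Dz))) _.
  rewrite lee_fin mulrCA ler_piMr ?(ltW s0)// ler_pdivrMr// mul1r; lra.
exact: ha.
Qed.

(** * Real parts in the closure *)

(* [P(x) S(y)] vanishes on the boundary of the square and is bounded below on
   the disc; [xP(x) S(y)] is its product with [x]. *)
Let c1 := complex.Re c.
Let c2 := complex.Im c.
Let P (x : R) := 4 * r ^+ 2 - (x - c1) ^+ 2.
Let P' (x : R) := - (2 * (x - c1)).
Let S (y : R) := 4 * r ^+ 2 - (y - c2) ^+ 2.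
Let S' (y : R) := - (2 * (y - c2)).
Let xP (x : R) := x * P x.
Let xP' (x : R) := P x + x * P' x.

Let dP (x : R) : is_derive x (1 : R) P (P' x).
Proof. by apply: is_derive_eq; rewrite /GRing.scale /= /P'; ring. Qed.
Let dS (x : R) : is_derive x (1 : R) S (S' x).
Proof. by apply: is_derive_eq; rewrite /GRing.scale /= /S'; ring. Qed.
Let dxP (x : R) : is_derive x (1 : R) xP (xP' x).
Proof. by have := dP x => h; apply: is_derive_eq; rewrite /GRing.scale /= /xP'; ring. Qed.

Let cid : continuous (fun x : R => x). Proof. by move=> x; exact: cvg_id. Qed.
Let cP' : continuous P'.
Proof. exact: contN (contM (@contC _ _ 2) (contD cid (contN (@contC _ _ c1)))). Qed.
Let cS' : continuous S'.
Proof. exact: contN (contM (@contC _ _ 2) (contD cid (contN (@contC _ _ c2)))). Qed.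
Let cxP' : continuous xP'.
Proof. exact: contD (derivative_continuous dP) (contM cid cP'). Qed.

Let cfst : continuous (fun z : R * R => z.1). Proof. by move=> z; exact: cvg_fst. Qed.
Let csnd : continuous (fun z : R * R => z.2). Proof. by move=> z; exact: cvg_snd. Qed.

Definition mollified (e : R) (g : R -> R) (z : R[i]) : R :=
  \int[area R]_(p in Q) (g p.1 * S p.2 * mollifier e (z - pt p)).

Lemma mollified_approx (g g' : R -> R) (t : R) :
  (forall x : R, is_derive x (1 : R) g (g' x)) -> continuous g' ->
  g (c1 - 2 * r) = 0 -> g (c1 + 2 * r) = 0 -> 0 < t ->
  exists2 e0 : R, 0 < e0 & forall e, 0 < e -> e <= e0 ->
  exists2 a, A a & forall z, D z -> normc ((2 * mollified e g z)%:C - a z) <= t.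
Proof.
move=> dg cg' gl gr t0.
have cg := derivative_continuous dg.
have r20 : 0 < 2 * r by rewrite mulr_gt0.
have bu : bmeas Q (fun p => (g' p.1 * S p.2) +i* (g p.1 * S' p.2)).
  apply: bmeas_continuous.
    exact: contM (cont_comp cg' cfst) (cont_comp (derivative_continuous dS) csnd).
  exact: contM (cont_comp cg cfst) (cont_comp cS' csnd).
have [e0 e00 he] := cauchy_transform_approx bu t0.
exists e0 => // e epos ee; have [a Aa ha] := he e epos ee; exists a => // z Dz.
suff <- : Cint Q (fun p => (g' p.1 * S p.2 +i* (g p.1 * S' p.2)) * reg_cauchy e (z - pt p)) =
   (2 * mollified e g z)%:C by exact: ha.
case: (z) => p q.
apply: cauchy_pompeiu_reg => //.
- by rewrite /S; ring.
- by rewrite /S; ring.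
Qed.

(** The mean is a Cauchy transform of a bounded function, and [1 / |w|] bounds
the regularised kernel for every [e]. *)
Lemma mollified_bounded : exists2 M : R, 0 < M & forall e z, 0 < e -> 2 * mollified e P z <= M.
Proof.
have r20 : 0 < 2 * r by rewrite mulr_gt0.
have bu : bmeas Q (fun p => (P' p.1 * S p.2) +i* (P p.1 * S' p.2)).
  apply: bmeas_continuous.
    exact: contM (cont_comp cP' cfst) (cont_comp (derivative_continuous dS) csnd).
  exact: contM (cont_comp (derivative_continuous dP) cfst) (cont_comp cS' csnd).
have [_ _ [V0 hV0]] := bu.
pose V := 1 + `|V0|; have V1 : 0 < V by rewrite ltr_pwDl.
have [J J0 hJ] := weight_bounded mQ fQ.
exists (2 * (V * J)); first by rewrite !mulr_gt0.
move=> e z e0.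
have E : Cint Q (fun p => (P' p.1 * S p.2 +i* (P p.1 * S' p.2)) * reg_cauchy e (z - pt p)) =
   (2 * mollified e P z)%:C.
  case: (z) => p q; apply: cauchy_pompeiu_reg => //.
  - by rewrite /P; ring.
  - by rewrite /P; ring.
  - by rewrite /S; ring.
  - by rewrite /S; ring.
rewrite (le_trans (ler_norm _))// -normcR -E.
have mw := measurable_weight z mQ.
apply: (@Cint_le R Q mQ fQ _ (fun p => V * weight Q z p)).
- by apply: bmeasM => //; exact: bmeas_reg_cauchy.
- exact: measurable_funM.
- move=> p Qp; rewrite normcM ler_pM ?normc_ge0//.
    by rewrite (le_trans (hV0 p Qp))// (le_trans (ler_norm _))// lerDr.
  by rewrite /weight indicE mem_set// mul1r normc_reg_cauchy.
exact: (integral_leZ mQ (ltW V1) mw (fun p => weight_ge0 Q z p) (hJ z)).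
Qed.

(** On the square of half-side [s] around [z], with [e = s^2], the mollifier is
at least [s^2 / (3 s^2)^2] and the two factors of the averaged function are at
least [r^2]; the area of that square is [4 s^2]. *)
Lemma mollified_ge (s : R) z : 0 < s -> s <= r / 2 -> D z ->
  4 / 9 * r ^+ 4 <= mollified (s ^+ 2) P z.
Proof.
move=> s0 sr Dz; have e0 : 0 < s ^+ 2 by rewrite exprn_gt0.
have r20 : 0 < 2 * r by rewrite mulr_gt0.
pose B := square (complex.Re z) (complex.Im z) s.
have mB : measurable B by exact: measurable_square.
have Bz p : B p -> [/\ `|p.1 - complex.Re z| <= s & `|p.2 - complex.Im z| <= s].
  move=> []; rewrite /= !in_itv /= => /andP[h1 h2] /andP[h3 h4].
  by split; apply/ler_normlP; split; lra.
have zc1 : `|complex.Re z - c1| <= r.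
  have := le_trans (Re_le_normc _) (Dz : normc (z - c) <= r).
  by rewrite raddfB.
have zc2 : `|complex.Im z - c2| <= r.
  have := le_trans (Im_le_normc _) (Dz : normc (z - c) <= r).
  by rewrite raddfB.
have Bc p : B p -> `|p.1 - c1| <= 3 / 2 * r /\ `|p.2 - c2| <= 3 / 2 * r.
  move=> /Bz[/ler_normlP[h1 h2] /ler_normlP[h3 h4]].
  move: zc1 zc2 => /ler_normlP[k1 k2] /ler_normlP[k3 k4].
  by split; apply/ler_normlP; split; lra.
have BQ : B `<=` Q.
  move=> p /Bc[/ler_normlP[h1 h2] /ler_normlP[h3 h4]].
  by split; rewrite /= in_itv /=; apply/andP; split; move: h1 h2 h3 h4; rewrite /c1 /c2; move: r0; lra.
have sqle (x y : R) : `|x| <= y -> x ^+ 2 <= y ^+ 2.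
  move=> h; have y0 := le_trans (normr_ge0 _) h.
  by rewrite -[x ^+ 2]real_normK ?num_real// lerXn2r// nnegrE.
pose f p := P p.1 * S p.2 * mollifier (s ^+ 2) (z - pt p).
pose k := r ^+ 4 / (9 * s ^+ 2).
have k0 : 0 <= k by rewrite divr_ge0 ?exprn_ge0 ?ltW// mulr_gt0.
have fk p : Q p -> k * \1_B p <= f p.
  move=> Qp; rewrite indicE; case: (boolP (p \in B)) => [|_].
    rewrite inE mulr1 => Bp; have [h1 h2] := Bc p Bp; have [g1 g2] := Bz p Bp.
    have hP : r ^+ 2 <= P p.1.
      by have := sqle _ _ h1; rewrite /P exprMn; have := sqr_ge0 r; lra.
    have hS : r ^+ 2 <= S p.2.
      by have := sqle _ _ h2; rewrite /S exprMn; have := sqr_ge0 r; lra.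
    have hn : normc (z - pt p) ^+ 2 <= 2 * s ^+ 2.
      rewrite normc_sqr !raddfB /=.
      have := sqle _ _ g1; have := sqle _ _ g2; rewrite -sqrrN opprB => i1.
      by rewrite -sqrrN opprB; lra.
    have hb : (9 * s ^+ 2)^-1 <= mollifier (s ^+ 2) (z - pt p).
      have n0 : 0 < normc (z - pt p) ^+ 2 + s ^+ 2 by rewrite ltr_wpDl ?sqr_ge0.
      have -> : (9 * s ^+ 2)^-1 = s ^+ 2 * (3 * s ^+ 2)^-1 ^+ 2.
        by field; rewrite gt_eqF.
      rewrite /mollifier ler_wpM2l ?(ltW e0)// lerXn2r ?nnegrE ?invr_ge0 ?(ltW n0)//.
        by rewrite mulr_ge0// ltW.
      by rewrite lef_pV2 ?posrE ?mulr_gt0//; lra.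
    rewrite /k /f ler_pM ?exprn_ge0 ?invr_ge0 ?mulr_ge0 ?(ltW e0) ?(ltW r0) ?(ltW s0)//.
    by rewrite -[4%N]/(2 + 2)%N exprD ler_pM ?sqr_ge0.
  rewrite mulr0 /f mulr_ge0//; last first.
    by rewrite /mollifier mulr_ge0 ?(ltW e0)// sqr_ge0.
  have [] := Qp; rewrite /= !in_itv /= => /andP[h1 h2] /andP[h3 h4].
  have q1 : `|p.1 - c1| <= 2 * r by apply/ler_normlP; split; move: h1 h2; rewrite /c1; lra.
  have q2 : `|p.2 - c2| <= 2 * r by apply/ler_normlP; split; move: h3 h4; rewrite /c2; lra.
  have := sqle _ _ q1; have := sqle _ _ q2; rewrite !exprMn => i1 i2.
  by rewrite mulr_ge0// /P /S; lra.
have cf : continuous f.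
  exact: contM (contM (cont_comp (derivative_continuous dP) cfst)
    (cont_comp (derivative_continuous dS) csnd)) (@mollifier_continuous R _ z e0).
have iB : (area R).-integrable Q (EFin \o (\1_B : plane R -> R)).
  apply: measurable_bounded_integrable => //.
  exists 1; split; rewrite ?num_real// => M M1 p Qp /=.
  by rewrite indicE ger0_norm// (le_trans _ (ltW M1))//; case: (_ \in _).
have ikB : (area R).-integrable Q (EFin \o (fun p => k * \1_B p)).
  exact: (integrableZl mQ k iB).
apply: le_trans (le_Rintegral mQ ikB (continuous_square_integrable _ _ r20 cf) fk).
rewrite RintegralZl// /Rintegral integral_indic// (setIidl BQ).
rewrite [area R B](area_square _ _ (ltW s0)) /= /k le_eqVlt; apply/orP; left; apply/eqP.
by field; rewrite gt_eqF.
Qed.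

(** [|x - Re z|] times the mollifier is at most the error of the regularised
kernel, hence small in mean. *)
Lemma mollified_multiplier (t : R) : 0 < t -> exists2 e0 : R, 0 < e0 & forall e z,
  0 < e -> e <= e0 -> `|mollified e xP z - complex.Re z * mollified e P z| <= t.
Proof.
move=> t0; have r20 : 0 < 2 * r by rewrite mulr_gt0.
have [_ _ [V0 hV0]] := bmeas_continuous c1 c2 (2 * r)
  (contM (cont_comp (derivative_continuous dP) cfst)
    (cont_comp (derivative_continuous dS) csnd)) (@contC _ _ 0).
pose V := 1 + `|V0|; have V1 : 0 < V by rewrite ltr_pwDl.
have [e0 e00 he] := reg_error_small (divr_gt0 t0 V1).
exists e0 => // e z epos ee; have [K [mK K0 hK iK]] := he e z epos ee.
have cg := contM (contM (cont_comp (derivative_continuous dP) cfst)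
    (cont_comp (derivative_continuous dS) csnd)) (@mollifier_continuous R _ z epos).
have cxg := contM (contM (cont_comp (derivative_continuous dxP) cfst)
    (cont_comp (derivative_continuous dS) csnd)) (@mollifier_continuous R _ z epos).
have cxg' := contM (@contC _ _ (complex.Re z)) cg.
have cd := contD cxg (contN cxg').
rewrite /mollified -RintegralZl//; last exact: continuous_square_integrable.
rewrite -RintegralB//; [|exact: continuous_square_integrable..].
have -> : t = V * (t / V) by rewrite mulrC divfK// gt_eqF.
apply: (@Rintegral_normr_le R Q mQ _ (fun p => V * K p)).
- exact: continuous_plane_measurable.
- exact: continuous_square_integrable.
- exact: measurable_funM.
- move=> p Qp.
  have -> : xP p.1 * S p.2 * mollifier e (z - pt p) - complex.Re z * (P p.1 * S p.2 * mollifier e (z - pt p))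
    = (P p.1 * S p.2) * ((p.1 - complex.Re z) * mollifier e (z - pt p)) by rewrite /xP; ring.
  rewrite normrM ler_pM//.
    have := hV0 p Qp; rewrite complexr0 normcR => h.
    by rewrite (le_trans h)// (le_trans (ler_norm _))// lerDr.
  rewrite (le_trans _ (hK p Qp))// normrM.
  set n := normc (z - pt p).
  have n0 : 0 < n ^+ 2 + e by rewrite ltr_wpDl ?sqr_ge0.
  have nn : 0 <= n := normc_ge0 _.
  have hx : `|p.1 - complex.Re z| <= n.
    rewrite distrC; have := Re_le_normc (z - pt p); by rewrite raddfB.
  rewrite [`|mollifier _ _|]ger0_norm; last by rewrite /mollifier mulr_ge0 ?(ltW epos)// sqr_ge0.
  apply: (@le_trans _ _ (n * mollifier e (z - pt p))).
    by rewrite ler_wpM2r// /mollifier mulr_ge0 ?(ltW epos)// sqr_ge0.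
  have [->|nz] := eqVneq n 0; first by rewrite mul0r invr0 mulr0.
  have np : 0 < n by rewrite lt_def nz nn.
  rewrite ler_pdivlMr// /mollifier -/n.
  have -> : n * (e * (n ^+ 2 + e)^-1 ^+ 2) * n = e / (n ^+ 2 + e) * (n ^+ 2 / (n ^+ 2 + e)).
    by field; rewrite gt_eqF.
  rewrite ler_piMr//; first by rewrite divr_ge0// ltW.
  by rewrite ler_pdivrMr// mul1r lerDl ltW.
exact: (integral_leZ mQ (ltW V1) mK K0 iK).
Qed.

(** The quotient of the means of [x m] and of [m].  Dividing by [U], a bound on
the second mean, brings its approximation [g2] within distance less than 1 from
1, so that its inverse stays in the closure. *)
Lemma Re_in_closure : buclos D A (fun z => (complex.Re z)%:C).
Proof.
have BA := subalg_buclos D AA; have [Bc BD BM] := BA.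
apply: buclos_idem => eta eta0.
have [M M0 hM] := mollified_bounded.
pose b0 := 8 / 9 * r ^+ 4.
have b00 : 0 < b0 by rewrite mulr_gt0 ?exprn_gt0// divr_gt0.
pose X := normc c + r.
have X0 : 0 <= X by rewrite addr_ge0 ?normc_ge0// ltW.
have hX z : D z -> `|complex.Re z| <= X.
  move=> Dz; rewrite (le_trans (Re_le_normc _))//.
  have -> : z = c + (z - c) by ring.
  by rewrite (le_trans (le_normcD _ _))// lerD2l.
pose t := Num.min (b0 / 2) (eta * (b0 / 2) / (3 + X)).
have t0 : 0 < t by rewrite lt_min !divr_gt0 ?mulr_gt0 ?divr_gt0// ltr_pwDl.
have tb : t <= b0 / 2 by rewrite ge_min lexx.
have tX : t * (3 + X) <= eta * (b0 / 2).
  rewrite -ler_pdivlMr; last by rewrite ltr_pwDl.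
  by rewrite ge_min lexx orbT.
have PE : P (c1 - 2 * r) = 0 by rewrite /P; ring.
have PE' : P (c1 + 2 * r) = 0 by rewrite /P; ring.
have [e1 e10 h1] := mollified_approx dP cP' PE PE' t0.
have xPE : xP (c1 - 2 * r) = 0 by rewrite /xP PE mulr0.
have xPE' : xP (c1 + 2 * r) = 0 by rewrite /xP PE' mulr0.
have [e2 e20 h2] := mollified_approx dxP cxP' xPE xPE' t0.
have [e3 e30 h3] := mollified_multiplier t0.
pose s := Num.min (r / 2) (Num.min 1 (Num.min e1 (Num.min e2 e3))).
have s0 : 0 < s by rewrite !lt_min divr_gt0//= ltr01 e10 e20 e30.
have sr : s <= r / 2 by rewrite ge_min lexx.
have s1 : s <= 1 by rewrite !ge_min lexx !orbT.
have se1 : s <= e1 by rewrite !ge_min lexx !orbT.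
have se2 : s <= e2 by rewrite !ge_min lexx !orbT.
have se3 : s <= e3 by rewrite !ge_min lexx !orbT.
have ss : s ^+ 2 <= s by rewrite expr2 ler_piMr// ltW.
have e0 : 0 < s ^+ 2 by rewrite exprn_gt0.
have [g2 Ag2 hg2] := h1 _ e0 (le_trans ss se1).
have [g1 Ag1 hg1] := h2 _ e0 (le_trans ss se2).
pose b z := 2 * mollified (s ^+ 2) P z.
pose a z := 2 * mollified (s ^+ 2) xP z.
have bM z : b z <= M by exact: hM.
have b0b z : D z -> b0 <= b z.
  by move=> Dz; have := mollified_ge s0 sr Dz; rewrite /b /b0; lra.
have ab z : `|a z - complex.Re z * b z| <= 2 * t.
  have := h3 _ z e0 (le_trans ss se3); rewrite /a /b => h.
  have -> : 2 * mollified (s ^+ 2) xP z - complex.Re z * (2 * mollified (s ^+ 2) P z) =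
    2 * (mollified (s ^+ 2) xP z - complex.Re z * mollified (s ^+ 2) P z) by ring.
  by rewrite normrM gtr0_norm// ler_wpM2l.
pose U := M + b0.
have U0 : 0 < U by rewrite addr_gt0.
have Uc0 : U%:C != 0 :> R[i] by rewrite eq_complex /= eqxx andbT gt_eqF.
have g2b z : D z -> normc (g2 z) <= U.
  move=> Dz; have -> : g2 z = (b z)%:C - ((b z)%:C - g2 z) by ring.
  rewrite (le_trans (le_normcB _ _))// /U normcR lerD//.
    by rewrite ger0_norm// (le_trans _ (b0b z Dz))// ltW.
  by rewrite (le_trans (hg2 z Dz))//; lra.
have cg2 : buclos D A (fun z => U%:C^-1 * g2 z).
  by apply: BM; [exact: Bc|apply: buclos_sub => //; exists U].
have q1 : 1 - b0 / 2 / U < 1 by rewrite ltrBlDr ltrDl divr_gt0// divr_gt0.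
have hq z : D z -> normc (1 - U%:C^-1 * g2 z) <= 1 - b0 / 2 / U.
  move=> Dz.
  have -> : 1 - U%:C^-1 * g2 z = U%:C^-1 * ((U - b z)%:C + ((b z)%:C - g2 z)).
    by rewrite rmorphB /= mulrDr !mulrBr mulVf//; ring.
  rewrite normcM normcV !normcR gtr0_norm// mulrC ler_pdivrMr//.
  rewrite mulrBl mul1r divfK ?gt_eqF// (le_trans (le_normcD _ _))//.
  rewrite normcR ger0_norm; last by have := bM z; rewrite /U; lra.
  by have := b0b z Dz; have := hg2 z Dz; rewrite -/(b z); lra.
have cinv := buclos_inv AA q1 hq cg2.
have g1b : bounded_on D g1.
  exists (t + (2 * t + X * M)) => z Dz.
  have -> : g1 z = (a z)%:C - ((a z)%:C - g1 z) by ring.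
  rewrite (le_trans (le_normcB _ _))// addrC lerD//; first exact: hg1.
  rewrite normcR; have -> : a z = (a z - complex.Re z * b z) + complex.Re z * b z by ring.
  rewrite (le_trans (ler_normD _ _))// lerD// normrM ler_pM//; first exact: hX.
  by rewrite ger0_norm// (le_trans _ (b0b z Dz))// ltW.
have cg1 : buclos D A g1 by exact: buclos_sub.
exists (fun z => U%:C^-1 * ((U%:C^-1 * g2 z)^-1 * g1 z)).
  exact: BM (Bc _) (BM _ _ cinv cg1).
move=> z Dz.
have g20 : b0 / 2 <= normc (g2 z).
  have := ler_normcB (b z)%:C ((b z)%:C - g2 z).
  have -> : (b z)%:C - ((b z)%:C - g2 z) = g2 z by ring.
  rewrite normcR ger0_norm; last by rewrite (le_trans _ (b0b z Dz))// ltW.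
  by have := hg2 z Dz; have := b0b z Dz; rewrite -/(b z); lra.
have g20' : 0 < normc (g2 z) by rewrite (lt_le_trans _ g20)// divr_gt0.
have g2n : g2 z != 0 by rewrite -normc_gt0.
have -> : (complex.Re z)%:C - U%:C^-1 * ((U%:C^-1 * g2 z)^-1 * g1 z) =
  ((complex.Re z)%:C * (g2 z - (b z)%:C) + ((complex.Re z * b z - a z)%:C + ((a z)%:C - g1 z))) / g2 z.
  have -> : (complex.Re z * b z - a z)%:C = (complex.Re z)%:C * (b z)%:C - (a z)%:C.
    by rewrite rmorphB rmorphM.
  move: (complex.Re z)%:C (b z)%:C (a z)%:C (g1 z) (g2 z) U%:C g2n Uc0 => x1 x2 x3 x4 x5 x6 h h'.
  by field; rewrite h h'.
rewrite normcM normcV ler_pdivrMr//.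
apply: (@le_trans _ _ (t * (3 + X))); last first.
  by rewrite (le_trans tX)// ler_wpM2l// ltW.
rewrite (le_trans (le_normcD _ _))//.
have k1 : normc ((complex.Re z)%:C * (g2 z - (b z)%:C)) <= X * t.
  rewrite normcM normcR ler_pM ?normc_ge0//; first exact: hX.
  by rewrite normcB; exact: hg2.
have k2 : normc ((complex.Re z * b z - a z)%:C + ((a z)%:C - g1 z)) <= 2 * t + t.
  rewrite (le_trans (le_normcD _ _))// lerD//; last exact: hg1.
  by rewrite normcR distrC.
by lra.
Qed.

Lemma conj_in_closure : buclos D A (@conjc R).
Proof.
have [Bc BD BM] := subalg_buclos D AA.
have bid : bounded_on D id.
  exists (normc c + r) => z Dz; have -> : id z = c + (z - c) by rewrite /=; ring.
  by rewrite (le_trans (le_normcD _ _))// lerD2l.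
have := BD _ _ (BM _ _ (Bc 2) Re_in_closure) (BM _ _ (Bc (-1)) (buclos_sub Aid bid)).
congr buclos; apply/funext => z; case: z => x y; apply/eqP; rewrite eq_complex /=.
by apply/andP; split; apply/eqP; ring.
Qed.

End Cover.

End CauchyKernelInAlgebra.

(** * Density of the polynomials in z and its conjugate *)
Section Density.
Variables (R : realType) (X : set R[i]) (A : set (R[i] -> R[i])) (f : R[i] -> R[i]).
Hypotheses (AA : subalg A) (Xid : buclos X A id) (Xconj : buclos X A (@conjc R)).
Hypothesis unif : forall e : R, 0 < e -> exists2 d : R, 0 < d &
  forall z w, X z -> X w -> normc (z - w) < d -> normc (f z - f w) <= e.
Hypothesis net : forall d : R, 0 < d -> exists n (y : 'I_n -> R[i]),
  (forall i, X (y i)) /\ forall z, X z -> exists i, normc (z - y i) < d.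
Hypothesis fb : bounded_on X f.

(** A partition of unity with members in the closure.  The functions
[(1 - |z - y_i|^2 / M^2)^m], for a finite net of points [y_i], are divided by
their sum.  At each [z] the node nearest to [z] contributes at least
[(1 - a)^m] to the sum, and a node at distance [d] or more at most
[(1 - 4 a)^m]; for large [m] the latter are negligible, and the averages of the
[f (y_i)] are close to [f z] by uniform continuity. *)
Lemma conj_dense : uclos X A f.
Proof.
have [Bc BD BM] := subalg_buclos X AA.
have BA := subalg_buclos X AA.
suff h : buclos X A f by case: h.
apply: buclos_idem => e e0.
have [Mf0 hMf0] := fb; pose Mf := 1 + `|Mf0|.
have Mf1 : 0 < Mf by rewrite /Mf ltr_pwDl.
have hMf z : X z -> normc (f z) <= Mf.
  by move=> Xz; rewrite (le_trans (hMf0 z Xz))// (le_trans (ler_norm _))// lerDr.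
have [_ [M0 hM0]] := Xid; pose M := 2 * (1 + `|M0|).
have M1 : 0 < M by rewrite /M mulr_gt0// ltr_pwDl.
have hM z w : X z -> X w -> normc (z - w) <= M.
  move=> Xz Xw; rewrite (le_trans (le_normcB _ _))//.
  by have := hM0 z Xz; have := hM0 w Xw; have := ler_norm M0; rewrite /M /=; lra.
have e20 : 0 < e / 2 by rewrite divr_gt0.
have [d d0 hd] := unif e20.
pose t := Num.min (d / 2) (M / 2).
have t0 : 0 < t by rewrite lt_min !divr_gt0.
have td : 2 * t <= d.
  have : t <= d / 2 by rewrite ge_min lexx.
  lra.
have tM : t <= M / 2 by rewrite ge_min lexx orbT.
have [n [y [Xy hy]]] := net t0.
pose a := (t / M) ^+ 2.
have a0 : 0 < a by rewrite exprn_gt0// divr_gt0.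
have a4 : a <= 1 / 4.
  have : t / M <= 1 / 2 by rewrite ler_pdivrMr//; lra.
  rewrite /a expr2 => h; have h' : 0 <= t / M by rewrite divr_ge0 ?ltW.
  have -> : (1 / 4 : R) = 1 / 2 * (1 / 2) by field.
  by rewrite ler_pM.
have a1 : 0 < 1 - a by lra.
pose q := (1 - 4 * a) / (1 - a).
have q01 : 0 <= q < 1.
  by rewrite divr_ge0 ?(ltW a1)//=; [rewrite ltr_pdivrMr//; lra|lra].
have n10 : 0 < n%:R + 1 :> R by rewrite ltr_wpDl.
have [m hm] := expr_small q01 (divr_gt0 e20 (mulr_gt0 (mulr_gt0 (ltr0Sn R 1) Mf1) n10)).
pose k (i : 'I_n) (z : R[i]) : R := (1 - (normc (z - y i) / M) ^+ 2) ^+ m.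
pose K z := \sum_(i < n) k i z.
have base z i : X z -> 0 <= 1 - (normc (z - y i) / M) ^+ 2 <= 1.
  move=> Xz; rewrite lerBlDr lerDl sqr_ge0 andbT subr_ge0.
  by rewrite exprn_ile1// ?divr_ge0 ?normc_ge0 ?(ltW M1)// ler_pdivrMr// mul1r hM.
have k01 z i : X z -> 0 <= k i z <= 1.
  by move=> Xz; have /andP[h1 h2] := base z i Xz; rewrite exprn_ge0//= exprn_ile1.
have K0 z : X z -> (1 - a) ^+ m <= K z.
  move=> Xz; have [i hi] := hy z Xz.
  rewrite /K (bigD1 i)//= -[leLHS]addr0 lerD//; last first.
    by apply: sumr_ge0 => j _; have /andP[] := k01 z j Xz.
  have /andP[h1 h2] := base z i Xz.
  rewrite /k lerXn2r ?nnegrE ?(ltW a1)// lerD2l lerN2 /a lerXn2r// ?nnegrE.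
  - by rewrite divr_ge0 ?normc_ge0// ltW.
  - by rewrite divr_ge0 ?ltW.
  - by rewrite ler_wpM2r ?invr_ge0 ?(ltW M1)// ltW.
have Kn z : X z -> K z <= n%:R.
  move=> Xz; have -> : n%:R = \sum_(i < n) (1 : R) by rewrite sumr_const card_ord.
  by apply: ler_sum => i _; have /andP[] := k01 z i Xz.
have am : 0 < (1 - a) ^+ m by rewrite exprn_gt0.
have Kpos z : X z -> 0 < K z by move=> Xz; exact: lt_le_trans (K0 z Xz).
have ck i : buclos X A (fun z => (k i z)%:C).
  have -> : (fun z => (k i z)%:C) =
     (fun z => (1 + (- (M ^- 2)%:C) * ((z + (- y i)) * (z^*%C + (- (y i)^*%C)))) ^+ m).
    apply/funext => z; rewrite /k rmorphXn /=; congr (_ ^+ m).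
    rewrite rmorphB /= exprMn rmorphM /= mulNr -mulNr; congr (_ + _).
    have -> : (normc (z - y i) ^+ 2)%:C = (z - y i) * (z^*%C - (y i)^*%C).
      rewrite normc_sqr; case: (z) (y i) => [x1 x2] [y1 y2]; apply/eqP.
      by rewrite eq_complex /=; apply/andP; split; apply/eqP; ring.
    by rewrite exprVn mulrC mulNr.
  apply: subalgX => //.
  exact: BD (Bc 1) (BM _ _ (Bc _) (BM _ _ (BD _ _ Xid (Bc _)) (BD _ _ Xconj (Bc _)))).
have cK : buclos X A (fun z => (K z)%:C).
  have := subalg_sum (index_enum 'I_n) BA ck.
  by congr buclos; apply/funext => z; rewrite /K rmorph_sum.
have nc0 : (n%:R + 1 : R)%:C != 0 :> R[i] by rewrite eq_complex /= eqxx andbT gt_eqF.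
pose W := (n%:R + 1 : R)%:C^-1.
have cW : buclos X A (fun z => W * (K z)%:C) by exact: BM (Bc _) cK.
have q1 : 1 - (1 - a) ^+ m / (n%:R + 1) < 1 by rewrite ltrBlDr ltrDl divr_gt0.
have hq z : X z -> normc (1 - W * (K z)%:C) <= 1 - (1 - a) ^+ m / (n%:R + 1).
  move=> Xz; have -> : 1 - W * (K z)%:C = (1 - K z / (n%:R + 1))%:C.
    by rewrite rmorphB rmorphM /= fmorphV /W mulrC.
  rewrite normcR ger0_norm; last first.
    by rewrite subr_ge0 ler_pdivrMr// mul1r (le_trans (Kn z Xz))// lerDl.
  by rewrite lerD2l lerN2 ler_wpM2r ?invr_ge0 ?(ltW n10)// K0.
have cinv := buclos_inv AA q1 hq cW.
pose g z := W * ((W * (K z)%:C)^-1 * \sum_(i < n) (k i z)%:C * f (y i)).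
have cs : buclos X A (fun z => \sum_(i < n) (k i z)%:C * f (y i)).
  apply: (subalg_sum (F := fun i z => (k i z)%:C * f (y i)) _ BA) => i.
  exact: BM (ck i) (Bc _).
exists g; first exact: BM (Bc _) (BM _ _ cinv cs).
move=> z Xz.
have Kc0 : (K z)%:C != 0 :> R[i] by rewrite eq_complex /= eqxx andbT gt_eqF ?Kpos.
have W0 : W != 0 by rewrite invr_eq0.
have -> : f z - g z = (\sum_(i < n) (k i z)%:C * (f z - f (y i))) / (K z)%:C.
  under eq_bigr do rewrite mulrBr.
  have sK : \sum_(i < n) (k i z)%:C = (K z)%:C by rewrite /K rmorph_sum.
  rewrite big_split /= sumrN -mulr_suml sK /g.
  move: (\sum_(i < n) (k i z)%:C * f (y i)) (K z)%:C Kc0 (f z) => u v v0 w.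
  by field; rewrite v0 W0.
rewrite normcM normcV normcR gtr0_norm ?Kpos// ler_pdivrMr ?Kpos//.
have nsum (F : 'I_n -> R[i]) : normc (\sum_(i < n) F i) <= \sum_(i < n) normc (F i).
  elim/big_rec2: _ => [|i u v _ h]; first by rewrite normc0.
  by rewrite (le_trans (le_normcD _ _))// lerD2l.
rewrite (le_trans (nsum _))//.
have term i : normc ((k i z)%:C * (f z - f (y i))) <=
    e / 2 * k i z + 2 * Mf * (1 - 4 * a) ^+ m.
  have /andP[h1 h2] := k01 z i Xz.
  rewrite normcM normcR ger0_norm//.
  have a4m : 0 <= (1 - 4 * a) ^+ m by rewrite exprn_ge0//; lra.
  have [hd'|hd'] := ltP (normc (z - y i)) d.
    rewrite -[leLHS]addr0 lerD//; last by rewrite mulr_ge0// mulr_ge0 ?ltW.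
    by rewrite mulrC ler_wpM2r// hd.
  rewrite -[leLHS]add0r lerD//; first by rewrite mulr_ge0// ltW.
  rewrite mulrC ler_pM ?normc_ge0//.
    by rewrite (le_trans (le_normcB _ _))//; have := hMf _ Xz; have := hMf _ (Xy i); lra.
  have /andP[b1 b2] := base z i Xz.
  rewrite /k lerXn2r ?nnegrE//; first by lra.
  rewrite lerD2l lerN2.
  have -> : 4 * a = (2 * t / M) ^+ 2 by rewrite /a; field; rewrite gt_eqF.
  rewrite lerXn2r ?nnegrE ?divr_ge0 ?normc_ge0 ?(ltW M1) ?mulr_ge0 ?(ltW t0)//.
  by rewrite ler_wpM2r ?invr_ge0 ?(ltW M1)// (le_trans td).
rewrite (le_trans (ler_sum _ (fun i _ => term i)))//.
rewrite big_split /= -mulr_sumr -/(K z) sumr_const card_ord -[X in _ + X]mulr_natl.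
have -> : e * K z = e / 2 * K z + e / 2 * K z by field.
rewrite lerD2l.
apply: (@le_trans _ _ (e / 2 * (1 - a) ^+ m)); last by rewrite ler_pM2l// K0.
rewrite -ler_pdivrMr//.
have -> : n%:R * (2 * Mf * (1 - 4 * a) ^+ m) / (1 - a) ^+ m = n%:R * (2 * Mf * q ^+ m).
  by rewrite /q expr_div_n; ring.
have q0m : 0 <= q ^+ m by rewrite exprn_ge0//; case/andP: q01.
have := ltW hm; rewrite ler_pdivlMr; last by rewrite !mulr_gt0.
have : 0 <= 2 * Mf * q ^+ m by rewrite mulr_ge0// mulr_ge0// ltW.
rewrite [q ^+ m * _]mulrC.
lra.
Qed.

End Density.

(** * Compactness of the disc *)
Section DiscFacts.
Variables (R : realType) (c : R[i]) (r : R).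

Lemma closed_discE z : closed_disc c r z <-> disc c r z.
Proof. by rewrite /closed_disc /closed_ball_ /disc /= normc_def lecR normcB; case: (c - z). Qed.

Lemma within_disc_continuousP (f : R[i]^o -> R[i]^o) :
  {within closed_disc c r, continuous f} -> forall z, disc c r z -> forall e : R, 0 < e ->
  exists2 d : R, 0 < d & forall w, disc c r w -> normc (z - w) < d -> normc (f z - f w) < e.
Proof.
move=> cf z Dz e e0.
have := (subspace_continuousP _ _).1 cf z ((closed_discE z).2 Dz).
have ec : 0 < e%:C :> R[i] by rewrite ltcR.
move=> /cvgrPdist_lt/(_ e%:C ec); rewrite near_withinE => /nbhs_ballP[d /= d0 hd].
have [d' d'0 dE] : exists2 d' : R, 0 < d' & d = d'%:C.
  case: (d) d0 => x y; rewrite ltcE /= => /andP[/eqP -> x0]; exists x => //.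
exists d' => // w Dw zw.
have := hd w; rewrite /ball /= dE normc_def ltcR => /(_ _ ((closed_discE w).2 Dw)).
rewrite normc_def ltcR => h.
have nE (x : R[i]) : normc x = Num.sqrt (complex.Re x ^+ 2 + complex.Im x ^+ 2) by case: x.
by rewrite nE; apply: h; rewrite -nE.
Qed.

End DiscFacts.

Section DiscCompactness.
Variables (R : realType) (c : R[i]) (r : R) (r0 : 0 < r) (f : R[i] -> R[i]).
Hypothesis cf : forall z, disc c r z -> forall e : R, 0 < e ->
  exists2 d : R, 0 < d & forall w, disc c r w -> normc (z - w) < d -> normc (f z - f w) < e.

Lemma within_plane_disc_continuous :
  {within plane_disc c r, continuous (fun p => complex.Re (f (pt p)))} /\
  {within plane_disc c r, continuous (fun p => complex.Im (f (pt p)))}.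
Proof.
have h (x : plane R) (e : R) : plane_disc c r x -> 0 < e ->
    \forall y \near within (plane_disc c r) (nbhs x), normc (f (pt x) - f (pt y)) < e.
  move=> Dx e0; have [d d0 hd] := cf Dx e0.
  by rewrite near_withinE; apply: filterS (near_pt x d0) => y hy Dy; exact: hd.
split; apply/subspace_continuousP => x Dx; apply/cvgrPdist_lt => e e0;
  apply: filterS (h x e Dx e0) => y; apply: le_lt_trans; rewrite -raddfB.
- exact: Re_le_normc.
- exact: Im_le_normc.
Qed.

Lemma disc_uniform_continuity (e : R) : 0 < e -> exists2 d : R, 0 < d &
  forall z w, disc c r z -> disc c r w -> normc (z - w) < d -> normc (f z - f w) <= e.
Proof.
move=> e0; have e20 : 0 < e / 2 by rewrite divr_gt0.
have : \forall d \near 0^'+, plane_disc c r `<=` (fun p => forall w, disc c r w ->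
    normc (pt p - w) < d -> normc (f (pt p) - f w) <= e).
  apply: (near_covering_withinP _).2.
    exact/compact_near_coveringP/plane_disc_compact.
  move=> x Dx; have [d d0 hd] := cf Dx e20.
  have d20 : 0 < d / 2 by rewrite divr_gt0.
  have nx := near_pt x d20.
  near=> x' d'.
  have d'd : d' <= d / 2 by near: d'; exact: nbhs_right_le.
  have xx' : normc (pt x - pt x') < d / 2 by near: x'.
  move=> /= Dx' w Dw wd.
  have h1 : normc (f (pt x) - f (pt x')) < e / 2 by apply: hd => //; lra.
  have h2 : normc (f (pt x) - f w) < e / 2.
    apply: hd => //; have -> : pt x - w = (pt x - pt x') + (pt x' - w) by ring.
    by rewrite (le_lt_trans (le_normcD _ _))//; lra.
  have -> : f (pt x') - f w = (f (pt x) - f w) - (f (pt x) - f (pt x')) by ring.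
  by rewrite (le_trans (le_normcB _ _))//; lra.
move=> [t /= t0 Ht]; have t20 : 0 < t / 2 by rewrite divr_gt0.
exists (t / 2) => // z w Dz Dw zw.
have tt : `|0 - t / 2| < t by rewrite sub0r normrN gtr0_norm//; lra.
have := Ht (t / 2) tt t20 (complex.Re z, complex.Im z).
by rewrite /plane_disc /mkset pt_ReIm; apply.
Unshelve. all: by end_near. Qed.

Lemma disc_net (d : R) : 0 < d -> exists n (y : 'I_n -> R[i]),
  (forall i, disc c r (y i)) /\ forall z, disc c r z -> exists i, normc (z - y i) < d.
Proof.
move=> d0.
(* Compactness is used as near-covering, along the filter generated, for the
   finite parts of the disc, by the sequences that contain them. *)
pose N : set_system (seq (R * R)) := [set S : set (seq (R * R)) | exists2 s0 : seq (R * R),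
  (forall x, x \in s0 -> plane_disc c r x) & forall s : seq (R * R), {subset s0 <= s} -> S s].
have NF : Filter N.
  split; first by exists [::].
  - move=> S1 S2 [s1 D1 h1] [s2 D2 h2]; exists (s1 ++ s2).
      by move=> x; rewrite mem_cat => /orP[/D1|/D2].
    move=> s sub; split; [apply: h1|apply: h2] => x xs; apply: sub;
      by rewrite mem_cat xs ?orbT.
  - by move=> S1 S2 S12 [s1 D1 h1]; exists s1 => // s /h1 /S12.
pose P (s : seq (R * R)) (p : plane R) := exists2 x, x \in s & normc (pt x - pt p) < d.
have [s0 D0 h0] : N [set s | plane_disc c r `<=` P s].
  apply: ((near_covering_withinP (plane_disc c r)).2 _ _ N P NF).
    exact/compact_near_coveringP/plane_disc_compact.
  move=> x Dx; exists ([set x' | normc (pt x - pt x') < d], [set s : seq (R * R) | x \in s]) => /=.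
    split; first exact: near_pt.
    by exists [:: x] => [y|s sub]; [rewrite inE => /eqP ->|apply: sub; rewrite inE].
  by move=> [x' s] /= [xx' xs] Dx'; exists x.
exists (size s0), (fun i => pt (nth (0, 0) s0 i)); split.
  by move=> i; apply: D0; exact: mem_nth.
move=> z Dz.
have Dz' : plane_disc c r (complex.Re z, complex.Im z) by rewrite /plane_disc /mkset pt_ReIm.
have [x xs zx] := h0 s0 (fun _ h => h) _ Dz'.
have xs' : (index x s0 < size s0)%N by rewrite index_mem.
by exists (Ordinal xs'); rewrite /= nth_index// normcB -{1}(pt_ReIm z).
Qed.

End DiscCompactness.

(** * Sectors and rational rays *)
Section Sectors.
Variable R : realType.

(** [ray_dir] and [ray_gap] enumerate together all pairs of a rational angle and
an aperture [1 / (m + 1)].  The sign makes [avoids_ray] exclude the ray of angle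
[q] itself. *)
Definition ray_dir (n : nat) : R[i] :=
  let t := if @unpickle (rat * nat)%type n is Some (q, _) then ratr q else 0 in
  - (cos t +i* sin t).

Definition ray_gap (n : nat) : R :=
  if @unpickle (rat * nat)%type n is Some (_, m) then m.+1%:R^-1 else 1.

Lemma normc_cis (t : R) : normc (cos t +i* sin t) = 1.
Proof. by rewrite /normc cos2Dsin2 sqrtr1. Qed.

Lemma ray_dir_gap n : [/\ 0 < ray_gap n, ray_gap n <= 1 & normc (ray_dir n) = 1].
Proof.
rewrite /ray_gap /ray_dir normcN normc_cis; split => //.
- by case: unpickle => [[_ m]|]; rewrite ?invr_gt0.
- by case: unpickle => [[_ m]|] //; rewrite invf_le1// ler1n.
Qed.

(** Between [m] and [2 pi - m] the cosine is largest at the end points. *)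
Lemma cos_gap (m v : R) : 0 < m -> m <= pi -> m <= v -> v <= 2 * pi - m -> cos v <= cos m.
Proof.
move=> m0 mpi mv vm.
have mI : m \in `[0, pi] by rewrite in_itv /= mpi ltW.
have [vpi|piv] := lerP v pi.
  rewrite leNgt ltr_cos// -?leNgt// in_itv /= vpi andbT.
  exact: le_trans (ltW m0) mv.
have -> : cos v = cos (2 * pi - v).
  rewrite cosB mulr_natl cos2pi sin2pi mul1r mul0r addr0//.
by rewrite leNgt ltr_cos// -?leNgt ?in_itv /=; [lra|apply/andP; split; lra].
Qed.

(** The arc complementary to [I] is open and not empty, hence contains a rational
angle [q], at angular distance at least some [m > 0] from [I].  A point
[s e^(it)] of the sector has distance at least [l sqrt (1 - k^2)] from
[l e^(iq)], where [k] is the positive part of [cos m]. *)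
Lemma sector_avoids (I : set R) : sector_interval I -> exists n, forall h,
  h = 0 \/ open_sector 0 I h -> avoids_ray (ray_gap n) (ray_dir n) h.
Proof.
move=> [a [b [ha ab hb ba IE]]].
have [|q /[!in_itv]/= /andP[qb qa]] := @rat_in_itvoo R b (a + 2 * pi); first by lra.
pose m := Num.min (ratr q - b) (a + 2 * pi - ratr q).
have m0 : 0 < m by rewrite lt_min; apply/andP; split; lra.
have m1 : m <= ratr q - b by rewrite ge_min lexx.
have m2 : m <= a + 2 * pi - ratr q by rewrite ge_min lexx orbT.
have mpi : m <= pi by lra.
have cm1 : cos m < 1.
  rewrite -cos0 ltr_cos// in_itv /=; first by rewrite lexx pi_ge0.
  by rewrite mpi ltW.
pose k := Num.max 0 (cos m).
have k0 : 0 <= k by rewrite le_max lexx.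
have k1 : k < 1 by rewrite gt_max ltr01.
pose kap := 1 - k ^+ 2.
have kap0 : 0 < kap by rewrite subr_gt0 expr_lt1.
have [M hM] : exists M, M.+1%:R^-1 < kap.
  have := @near_infty_natSinv_lt R (PosNum kap0).
  by case=> M _ /(_ M (leqnn M)) /= ?; exists M.
exists (pickle (q, M)) => h hI l l0.
rewrite /ray_gap /ray_dir pickleK.
have M1 : M.+1%:R^-1 <= 1 :> R by rewrite invf_le1// ler1n.
have M0 : 0 < M.+1%:R^-1 :> R by rewrite invr_gt0.
move: hM M1 M0; set g := M.+1%:R^-1 => hM M1 M0.
case: hI => [->|[s [t [s0]]]].
  rewrite add0r normcM normcN normc_cis mulr1 normcR ger0_norm//.
  by rewrite ler_piMl.
rewrite IE /= in_itv /= => /andP[ta tb] ->.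
rewrite add0r -(ler_pXn2r (n:=2)) ?nnegrE ?normc_ge0 ?mulr_ge0 ?(ltW M0)//.
rewrite normc_sqr /= !mul0r !subr0 !addr0.
have cv : cos (ratr q - t) <= k.
  by rewrite le_max cos_gap ?orbT//; lra.
have E1 := cos2Dsin2 t; have E2 := cos2Dsin2 (ratr q : R).
move: cv; rewrite cosB.
set ct := cos t in E1 *; set st := sin t in E1 *.
set cq := cos (ratr q) in E2 *; set sq := sin (ratr q) in E2 *.
move=> cv.
have -> : (s * ct + l * - cq) ^+ 2 + (s * st + l * - sq) ^+ 2 =
   s ^+ 2 * (ct ^+ 2 + st ^+ 2) + l ^+ 2 * (cq ^+ 2 + sq ^+ 2) - 2 * (s * l) * (cq * ct + sq * st).
  by ring.
rewrite E1 E2 !mulr1.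
have sl : 0 <= s * l by rewrite mulr_ge0// ltW.
have h1 : s * l * (cq * ct + sq * st) <= s * l * k by rewrite ler_wpM2l.
have h2 : 0 <= (s - l * k) ^+ 2 by rewrite sqr_ge0.
have h3 : (g * l) ^+ 2 <= l ^+ 2 * kap.
  rewrite exprMn mulrC ler_wpM2l ?sqr_ge0// (le_trans _ (ltW hM))//.
  by rewrite expr2 ler_piMr// ltW.
by rewrite (le_trans h3)// /kap; lra.
Qed.

End Sectors.

(** * The algebra of polynomials in z and F *)
Section PolynomialAlgebra.
Variables (R : realType) (F : R[i]^o -> R[i]^o).

Definition poly_alg : set (R[i] -> R[i]) := [set g | exists p : mpoly.mpoly 2 R[i],
  g = fun z => mpoly.meval (fun i => tnth [tuple idfun; F] i z) p].

Lemma subalg_poly_alg : subalg poly_alg.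
Proof.
split.
- by move=> c; exists (mpoly.mpolyC 2 c); apply/funext => z; rewrite mpoly.mevalC.
- move=> _ _ [p ->] [q ->]; exists (p + q); apply/funext => z.
  by rewrite mpoly.mevalD.
- move=> _ _ [p ->] [q ->]; exists (p * q); apply/funext => z.
  by rewrite mpoly.mevalM.
Qed.

Lemma poly_alg_id : poly_alg id.
Proof.
exists (mpoly.mpolyX _ (mpoly.mnm1 (ord0 : 'I_2))); apply/funext => z.
by rewrite mpoly.mevalXU.
Qed.

Lemma poly_alg_F : poly_alg F.
Proof.
exists (mpoly.mpolyX _ (mpoly.mnm1 (ord_max : 'I_2))); apply/funext => z.
by rewrite mpoly.mevalXU.
Qed.

End PolynomialAlgebra.

(** * Approximation on a disc *)
Theorem theorem1p1 (R : realType) (c : R[i]^o) (r : R) (hr : 0 < r)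
  (F : R[i]^o -> R[i]^o) (hF : continuous_on (closed_disc c r) F)
  (E : set R[i]^o) (hED : E `<=` closed_disc c r) (hE : lebesgue_null E)
  (hcount : forall zeta, (closed_disc c r `\` E) zeta ->
    countable (level_set (closed_disc c r) F zeta))
  (hsector : forall zeta, (closed_disc c r `\` E) zeta ->
    exists I : set R, sector_interval I /\
      forall z, (closed_disc c r `\` level_set (closed_disc c r) F zeta) z ->
        open_sector 0 I ((z - zeta) * (F z - F zeta))) :
  poly_closure (closed_disc c r) [tuple idfun; F] =
    continuous_on (closed_disc c r).
Proof.
apply/seteqP; split => [f [] //|f cf]; split => // eps eps0.
have cF' := within_disc_continuousP hF.
have cf' := within_disc_continuousP cf.
have [cFr cFi] := within_plane_disc_continuous cF'.
have [cfr cfi] := within_plane_disc_continuous cf'.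
have [N [mN N0 EN]] := hE.
have AA := subalg_poly_alg F.
have cover p : plane_disc c r p -> ~ N p ->
    exists n, sector_points c r F (ray_gap R n) (ray_dir R n) p.
  move=> Dp Np.
  have DE : (closed_disc c r `\` E) (pt p).
    by split; [exact/closed_discE|move=> Ep; apply: Np; exact: EN].
  have [I [sI hI]] := hsector _ DE; have [n hn] := sector_avoids sI.
  exists n; split => // z Dz; apply: hn.
  have [Fz|Fz] := pselect (F z = F (pt p)); first by left; rewrite Fz subrr mulr0.
  by right; apply: hI; split; [exact/closed_discE|move=> [_]].
(* A level set with a point outside [E] is countable; otherwise it is part of
   [E]. *)
have lev z : disc c r z -> exists M, [/\ measurable M, area R M = 0%E &
    [set p | plane_disc c r p /\ F (pt p) = F z] `<=` M].
  move=> Dz.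
  have [[p [Dp Fp Ep]]|none] := pselect (exists p, [/\ plane_disc c r p, F (pt p) = F z & ~ E (pt p)]).
    have cL : countable [set q | plane_disc c r q /\ F (pt q) = F z].
      have DE : (closed_disc c r `\` E) (pt p) by split => //; exact/closed_discE.
      pose h (w : R[i]) : plane R := (complex.Re w, complex.Im w).
      have sub : [set q | plane_disc c r q /\ F (pt q) = F z] `<=`
          h @` level_set (closed_disc c r) F (pt p).
        move=> [x y] [Dq Fq]; exists (pt (x, y)) => //; split; first exact/closed_discE.
        by rewrite Fq.
      apply: card_le_trans (subset_card_le sub) _.
      exact: card_le_trans (card_image_le _ _) (hcount _ DE).
    exact: countable_abscissa_null.
  exists N; split => // p [Dp Fp]; apply: EN => /=.
  by apply: contrapT => Ep; apply: none; exists p.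
have cconj := conj_in_closure hr AA (poly_alg_id F) (poly_alg_F F) cFr cFi mN N0
  (ray_dir_gap R) cover lev.
have [M _ fM] := disc_bounded hr cfr cfi.
have bid : bounded_on (disc c r) id.
  exists (normc c + r) => z Dz; have -> : id z = c + (z - c) by rewrite /=; ring.
  by rewrite (le_trans (le_normcD _ _))// lerD2l.
have := conj_dense AA (buclos_sub (poly_alg_id F) bid) cconj
  (disc_uniform_continuity hr cf') (disc_net c hr) (ex_intro _ M fM).
have e20 : 0 < eps / 2 by rewrite divr_gt0.
move=> /(_ _ e20)[_ [p ->] hp].
exists p => z /closed_discE Dz; rewrite normc_def ltcR.
have nE (x : R[i]) : Num.sqrt (complex.Re x ^+ 2 + complex.Im x ^+ 2) = normc x by case: x.
by rewrite nE (le_lt_trans (hp z Dz))//; lra.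
Qed.
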